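(* Let $(W,S)$ be an affine Coxeter system. For every direction $\varphi\in\mathrm{Dir}(W)$, all $x\in W$ and all $s\in S$ the following holds. (i) If $s$ is in the right descent set $D_R(x)$ of $x$, then $$\mathrm{Sh}_\varphi(x)=\mathrm{Sh}_\varphi(xs)\cdot s\;\cup\;\{z\in \mathrm{Sh}_\varphi(xs) : \mathrm{v}_\varphi(zs)<\mathrm{v}_\varphi(z)\}.$$ (ii) If $s$ is in the left descent set $D_L(x)$ of $x$, then $$\mathrm{Sh}_\varphi(x)=\begin{cases} s\cdot \mathrm{Sh}_{s\varphi}(sx)\cup \mathrm{Sh}_\varphi(sx) & \text{if } \mathrm{v}_\varphi(s)<0,\\ s\cdot \mathrm{Sh}_{s\varphi}(sx) & \text{if } \mathrm{v}_\varphi(s)>0.\end{cases}$$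
   Context: Coxeter complex. $\Sigma=\Sigma(W,S)$ is the Coxeter complex; its alcoves (maximal simplices) are identified with the elements of $W$, and its panels (codimension-one faces) with the cosets $xW_{\{s\}}=\{x,xs\}$, $x\in W,\ s\in S$. The panel $xW_{\{s\}}$ has type $s$ and is contained exactly in the alcoves $x$ and $xs$. $W$ acts on $\Sigma$ by left multiplication. For a reflection $r\in R=\bigcup_{x}xSx^{-1}$, $H_r$ denotes its hyperplane (wall); the panel $xW_{\{s\}}$ lies in $H_{xsx^{-1}}$. $\ell$ is word length with respect to $S$; $D_R(x)=\{s\in S:\ell(xs)<\ell(x)\}$, $D_L(x)=\{s\in S:\ell(sx)<\ell(x)\}$. The alcove of the identity element is denoted $\mathbf 1$. Affine setting. The affine Coxeter group $W$ acts on a Euclidean space tiled by $\Sigma$; $W=T\rtimes W_0$ with $T$ the translation subgroup and $W_0$ (the spherical Weyl group) the stabilizer of a fixed special vertex $0$ of the alcove $\mathbf 1$. For $v$ in the $T$-orbit of $0$, the closures of the connected components of the complement of the union of all hyperplanes through $v$ are called Weyl chambers. A direction is a class of Weyl chambers modulo translation (equivalently a chamber of the boundary sphere $\partial\Sigma$); $\mathrm{Dir}(W)$ is the set of directions. $W$ acts on $\mathrm{Dir}(W)$ by acting on representatives (so $T$ acts trivially). Orientation. For $\varphi\in\mathrm{Dir}(W)$ and a hyperplane $H$, the $\varphi$-positive side of $H$ is the half-space of $H$ that contains some Weyl chamber representing $\varphi$; the other one is the $\varphi$-negative side. (This is the Weyl chamber orientation of $\varphi$.) Galleries. A gallery is a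 sequence $\gamma=(c_0,p_1,c_1,\dots,p_n,c_n)$ of alcoves $c_i$ and panels $p_i$ with $p_i$ contained in both $c_{i-1}$ and $c_i$ (and $c_{i-1}=c_i$ is allowed). Its type is the word formed by the types of $p_1,\dots,p_n$. It is $\varphi$-positively folded if for every $i$ with $c_{i-1}=c_i$ the alcove $c_i$ lies on the $\varphi$-positive side of the hyperplane containing $p_i$. Shadow. $\mathrm{Sh}_\varphi(x)$ is the set of all $y\in W$ such that there is a $\varphi$-positively folded gallery of type $w$ from $\mathbf 1$ to $y$, where $w$ is a reduced word for $x$ (the set does not depend on the choice of $w$). Valuation. For an alcove $c$, $\mathrm{v}_\varphi(c)\in\mathbb Z$ is the number of hyperplanes separating $c$ from $\mathbf 1$ for which $c$ is on the $\varphi$-positive side, minus the number of hyperplanes separating $c$ from $\mathbf 1$ for which $c$ is on the $\varphi$-negative side. For $x\in W$, $\mathrm{v}_\varphi(x)$ is the value at the alcove of $x$. For $A\subseteq W$, $A\cdot s=\{as:a\in A\}$ and $s\cdot A=\{sa:a\in A\}$. *)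

(* Defs.v *)
From HB Require Import structures.
From mathcomp Require Import all_boot all_order all_algebra.
From mathcomp Require Import finmap.
From mathcomp Require Import all_classical all_reals all_analysis.

Set Implicit Arguments.
Unset Strict Implicit.
Unset Printing Implicit Defensive.

Import Order.TTheory GRing.Theory Num.Theory numFieldNormedType.Exports.

Local Open Scope classical_set_scope.

Section CoxeterSystems.
Variables (W : groupType) (S : set W).
Local Open Scope group_scope.

Definition word (x : W) (w : seq W) : Prop :=
  (forall s, s \in w -> S s) /\ \prod_(s <- w) s = x.

(* The third clause is the universal property of the presentation
   < S | (s t)^(m(s,t)) = 1 >, where m(s,t) is the order of s t in W
   (no relation for a pair with s t of infinite order); the case s = t, k = 1
   gives the relations s^2 = 1. *)
Definition coxeter_system : Prop :=
  [/\ forall s, S s -> s != 1 /\ s * s = 1,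
      forall x, exists w, word x w
    & forall (G : groupType) (f : W -> G),
        (forall s t k, S s -> S t -> (s * t) ^+ k = 1 ->
           (f s * f t) ^+ k = 1) ->
        exists2 g : W -> G,
          forall x y, g (x * y) = g x * g y & forall s, S s -> g s = f s].

(* The value is 0 if x is not a product of elements of S, which does not
   happen in a Coxeter system. *)
Definition len (x : W) : nat :=
  match pselect (exists n, `[< exists2 w, word x w & size w = n >]) with
  | left ex_word => ex_minn ex_word
  | right _ => 0%N
  end.

Definition reduced_word (x : W) (w : seq W) : Prop :=
  word x w /\ size w = len x.

Definition right_descent (x : W) : set W :=
  [set s | S s /\ (len (x * s) < len x)%N].

Definition left_descent (x : W) : set W :=
  [set s | S s /\ (len (s * x) < len x)%N].

Definition reflections : set W :=
  [set r | exists x s, S s /\ r = x * s * x^-1].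

(* The panel x W_{s}, as the coset {x, x s}; an alcove c contains it iff c is
   a member of this set. *)
Definition panel (x s : W) : set W := [set x; x * s].

Definition is_panel (p : set W) : Prop :=
  exists x s, S s /\ p = panel x s.

Definition panel_type (p : set W) (s : W) : Prop :=
  S s /\ exists x, p = panel x s.

(* (c_0, [:: (p_1, c_1); ...; (p_n, c_n)]) stands for the sequence
   (c_0, p_1, c_1, ..., p_n, c_n). *)
Definition pregallery : Type := (W * seq (set W * W))%type.

Fixpoint gallery_from (c : W) (g : seq (set W * W)) : Prop :=
  if g is (p, c') :: g' then
    [/\ is_panel p, p c, p c' & gallery_from c' g']
  else True.

Definition is_gallery (g : pregallery) : Prop := gallery_from g.1 g.2.

Definition gallery_end (g : pregallery) : W := last g.1 (unzip2 g.2).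

Fixpoint panels_type (ps : seq (set W)) (w : seq W) : Prop :=
  match ps, w with
  | [::], [::] => True
  | p :: ps', s :: w' => panel_type p s /\ panels_type ps' w'
  | _, _ => False
  end.

Definition gallery_type (g : pregallery) (w : seq W) : Prop :=
  panels_type (unzip1 g.2) w.

End CoxeterSystems.

Section Euclidean.
Variables (R : realType) (n : nat).
Local Notation E := 'rV[R]_n.
Local Open Scope ring_scope.

(* The norm that the library puts on 'rV[R]_n is the sup norm, so the Euclidean
   structure is given through the standard inner product.  The topology of
   'rV[R]_n is the usual one. *)
Definition dotp (u v : E) : R := \sum_(i < n) u 0 i * v 0 i.

Definition isometry (f : E -> E) : Prop :=
  forall u v, dotp (f u - f v) (f u - f v) = dotp (u - v) (u - v).

Definition orthogonal_reflection (f : E -> E) : Prop :=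
  exists (a : E) (c : R), a != 0 /\
    forall v, f v = v - (2 * (dotp a v - c) / dotp a a) *: a.

Definition half_space (H D : set E) : Prop :=
  exists (a : E) (c : R),
    [/\ a != 0, H = [set v | dotp a v = c] & D = [set v | c <= dotp a v]].

Definition translate (u : E) (A : set E) : set E := [set v + u | v in A].

Definition parallel (H H' : set E) : Prop := exists u, H' = translate u H.

Definition complement (Hs : set (set E)) : set E := ~` \bigcup_(H in Hs) H.

Definition chamber (Hs : set (set E)) (C : set E) : Prop :=
  exists2 v, complement Hs v & C = connected_component (complement Hs) v.

Definition locally_finite (Hs : set (set E)) : Prop :=
  forall v : E, exists2 U, nbhs v U &
    finite_set [set H | Hs H /\ H `&` U !=set0].

(* H supports a face of codimension one of the closure of C: that closure
   meets H in a point that is on no other hyperplane of the family. *)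
Definition wall_of_chamber (Hs : set (set E)) (C H : set E) : Prop :=
  Hs H /\ exists v, [/\ closure C v, H v &
    forall H', Hs H' -> H' v -> H' = H].

Definition through (Hs : set (set E)) (v : E) : set (set E) :=
  [set H | Hs H /\ H v].

Definition special_vertex (Hs : set (set E)) (v : E) : Prop :=
  \bigcap_(H in through Hs v) H = [set v] /\
  forall H, Hs H -> exists2 H', through Hs v H' & parallel H H'.

(* On opposite sides: for H a hyperplane, D and D' are the two closed
   half-spaces of H. *)
Definition separates (H A B : set E) : Prop :=
  exists D D', [/\ half_space H D, half_space H D', D <> D',
    A `<=` D & B `<=` D'].

End Euclidean.

Section Realization.
Variables (R : realType) (n : nat) (W : groupType) (S : set W).
Local Notation E := 'rV[R]_n.

Section Action.
Variable act : W -> E -> E.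

Definition fixed_points (r : W) : set E := [set v | act r v = v].

Definition hyperplanes : set (set E) := fixed_points @` reflections S.

End Action.

(* The tiling of Euclidean n-space by the Coxeter complex of (W, S): W acts
   faithfully by isometries, the elements of S act as the orthogonal
   reflections in the walls of a bounded chamber of the (locally finite)
   family of the hyperplanes of all reflections; the closure of this chamber
   is the alcove of the identity.  The boundedness of the alcoves, together
   with faithfulness, is what singles out the affine Coxeter systems among
   those generated by reflections of a Euclidean space.  A special vertex of
   the base alcove is part of the data; reducible systems are allowed. *)
Record affine_realization := AffineRealization {
  act : W -> E -> E;
  base_chamber : set E;
  origin : E;
  act1 : forall v, act 1%g v = v;
  actM : forall x y v, act (x * y)%g v = act x (act y v);
  act_faithful : forall x, (forall v, act x v = v) -> x = 1%g;
  act_isometry : forall x, isometry (act x);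
  act_reflection : forall s, S s -> orthogonal_reflection (act s);
  hyperplanes_locally_finite : locally_finite (hyperplanes act);
  base_chamberP : chamber (hyperplanes act) base_chamber;
  base_chamber_bounded : bounded_set base_chamber;
  base_chamber_walls : forall H,
    wall_of_chamber (hyperplanes act) base_chamber H <->
    exists2 s, S s & H = fixed_points act s;
  origin_base : closure base_chamber origin;
  origin_special : special_vertex (hyperplanes act) origin
}.

Variable A : affine_realization.
Local Notation Hyps := (hyperplanes (act A)).

Definition alcove (x : W) : set E := act A x @` closure (base_chamber A).

Definition panel_hyperplane (p : set W) (H : set E) : Prop :=
  exists x s, [/\ S s, p = panel x s &
    H = fixed_points (act A) (x * s * x^-1)%g].

Definition translation (t : W) : Prop :=
  exists u : E, forall v, act A t v = (v + u)%R.

Definition weyl_chamber (K : set E) : Prop :=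
  exists t C, [/\ translation t,
    chamber (through Hyps (act A t (origin A))) C & K = closure C].

Definition direction (phi : set (set E)) : Prop :=
  exists2 K, weyl_chamber K &
    phi = [set K' | weyl_chamber K' /\ exists u, K' = translate u K].

Definition act_direction (x : W) (phi : set (set E)) : set (set E) :=
  [set act A x @` K | K in phi].

Section Orientation.
Variable phi : set (set E).

Definition positive_half_space (H D : set E) : Prop :=
  half_space H D /\ exists2 K, phi K & K `<=` D.

Definition negative_half_space (H D : set E) : Prop :=
  half_space H D /\ exists2 D', positive_half_space H D' & D <> D'.

Definition on_positive_side (H : set E) (c : W) : Prop :=
  exists2 D, positive_half_space H D & alcove c `<=` D.

Definition on_negative_side (H : set E) (c : W) : Prop :=
  exists2 D, negative_half_space H D & alcove c `<=` D.

Fixpoint positively_folded_from (c : W) (g : seq (set W * W)) : Prop :=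
  if g is (p, c') :: g' then
    (c = c' -> exists2 H, panel_hyperplane p H & on_positive_side H c') /\
    positively_folded_from c' g'
  else True.

Definition positively_folded (g : pregallery W) : Prop :=
  positively_folded_from g.1 g.2.

Definition shadow (x : W) : set W :=
  [set y | exists w g,
     [/\ reduced_word S x w, is_gallery S g & gallery_type S g w] /\
     [/\ g.1 = 1%g, gallery_end g = y & positively_folded g]].

Definition separating (c : W) : set (set E) :=
  [set H | Hyps H /\ separates H (alcove c) (alcove 1%g)].

(* fset_set returns the empty set on infinite sets; here local finiteness
   makes the sets of separating hyperplanes finite. *)
Definition valuation (c : W) : int :=
  (#|` fset_set [set H | separating c H /\ on_positive_side H c] |%:Z -
   #|` fset_set [set H | separating c H /\ on_negative_side H c] |%:Z)%R.

End Orientation.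
End Realization.

(* Main.v *)
(* Recursions (i) and (ii) amount to peeling off the last or the first letter of a
   reduced word, once it is known that the alcoves reached by positively folded
   galleries of type w do not depend on the reduced word w.  Only finitely many
   walls occur in such galleries, and for these the positive side is the side not
   containing a suitable alcove a deep in the chamber opposite to phi.  Translating
   by a^-1, folding at u with s is allowed exactly when us < u; these folds on the
   right commute with the analogous ones on the left, and a^-1 is itself reached from
   1 by left multiplications alone, so the alcoves reached from a^-1 are obtained by
   left folds from those reached from 1, which is only x.  The valuation enters
   because H_{z s z^-1} is the only wall separating z from zs, so that v(z) - v(zs)
   is 1 or -1 according to the side of z. *)
Require Import Defs.
From mathcomp Require Import all_boot all_order all_algebra.
From mathcomp Require Import finmap.
From mathcomp Require Import all_classical all_reals all_analysis.
From mathcomp Require Import ring lra.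

Set Implicit Arguments.
Unset Strict Implicit.
Unset Printing Implicit Defensive.

Import Order.TTheory GRing.Theory Num.Theory numFieldNormedType.Exports.

(** * End alcoves of folded galleries, in terms of words *)

Section Reach.
Variables (W : groupType) (pos : W -> W -> Prop).
Local Open Scope group_scope.

(** Galleries stripped of their panels: each letter either crosses to [c * s] or folds at [c], the
    latter only where [pos] allows it. The element [c * s * c^-1] is the reflection in the wall of
    the panel at hand. *)
Fixpoint reach (w : seq W) (c y : W) : Prop :=
  if w is s :: w' then
    reach w' (c * s) y \/ pos (c * s * c^-1) c /\ reach w' c y
  else y = c.

Lemma reach_rcons w s c y : reach (rcons w s) c y <->
  exists2 z, reach w c z & y = z * s \/ pos (z * s * z^-1) z /\ y = z.
Proof.
elim: w c => [|t w IH] c /=; first by split=> [|[z ->]] //; exists c.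
rewrite !IH; split.
  by case=> [[z rz zy]|[pc [z rz zy]]]; exists z => //; [left|right].
case=> z [rz|[pc rz]] zy; first by left; exists z.
by right; split => //; exists z.
Qed.

(** All walls at which a gallery of type [w] from [c] might fold, whether or not the fold is
    allowed. The list is finite, so two fold rules need to be compared on finitely many walls
    only. *)
Fixpoint walls_met (w : seq W) (c : W) : seq W :=
  if w is s :: w' then c * s * c^-1 :: walls_met w' (c * s) ++ walls_met w' c
  else [::].

End Reach.

(** Left multiplication by [g] maps galleries to galleries of the same type and conjugates the
    reflections in their walls. *)
Lemma reach_mull (W : groupType) (P Q : W -> W -> Prop) (g : W) w c y :
  (forall r d, r \in walls_met w c -> P (g * r * g^-1)%g (g * d)%g <-> Q r d) ->
  reach P w (g * c)%g (g * y)%g <-> reach Q w c y.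
Proof.
elim: w c => [|s w IH] c /= PQ; first by split=> [/(mulgI g)|->].
rewrite -mulgA (IH (c * s)%g) => [|r d rw]; last by apply: PQ; rewrite inE mem_cat rw /= orbT.
rewrite (IH c) => [|r d rw]; last by apply: PQ; rewrite inE mem_cat rw !orbT.
by rewrite -(PQ (c * s * c^-1)%g c) ?inE ?eqxx // invgM !mulgA.
Qed.

(** * Folding away from the identity, from abstract properties of separation *)

Section Separation.
Variables (W : groupType) (S refl : W -> Prop) (sep : W -> W -> W -> bool).
Local Open Scope group_scope.
Hypothesis mulSS : forall s, S s -> s * s = 1.
Hypothesis refl_S : forall s, S s -> refl s.
Hypothesis reflJ : forall g r, refl r -> refl (g * r * g^-1).
Hypothesis sep_trans :
  forall r x y z, refl r -> sep r x z = sep r x y (+) sep r y z.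
Hypothesis sepJ :
  forall g r x y, refl r -> sep (g * r * g^-1) (g * x) (g * y) = sep r x y.
Hypothesis sep_simple : forall r s, refl r -> S s -> sep r 1 s = (r == s).

Definition inversion (u r : W) := sep r 1 u.

Lemma inv_simple s : S s -> s^-1 = s.
Proof. by move=> /mulSS ss; apply: mulg1_eq. Qed.

Lemma inversion1 r : refl r -> inversion 1 r = false.
Proof. by move=> rr; have := sep_trans 1 1 1 rr; rewrite /inversion; case: sep. Qed.

(** Multiplying by [u^-1] reduces this to the alcoves [1] and [s], which only the wall of [s]
    separates. *)
Lemma sep_mulr r u s : refl r -> S s -> sep r u (u * s) = (r == u * s * u^-1).
Proof.
move=> rr Ss; have ruE : r = u * (u^-1 * r * u) * u^-1.
  by rewrite !mulgA mulgV mul1g mulgK.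
have rr' : refl (u^-1 * r * u) by rewrite -{2}[u]invgK; apply: reflJ.
have -> : sep r u (u * s) = (u^-1 * r * u == s).
  by rewrite -sep_simple // -[RHS](sepJ u) // mulg1 -ruE.
apply/eqP/eqP => [<- //|->].
by rewrite !mulgA mulVg mul1g mulgVK.
Qed.

Lemma inversion_mulr r u s : refl r -> S s ->
  inversion (u * s) r = (r == u * s * u^-1) (+) inversion u r.
Proof. by move=> rr Ss; rewrite /inversion (sep_trans 1 u) // sep_mulr // addbC. Qed.

Lemma inversion_mull r u t : refl r -> S t ->
  inversion (t * u) r = (r == t) (+) inversion u (t * r * t).
Proof.
move=> rr St; have tt : t * t = 1 := mulSS St; have tV := inv_simple St.
rewrite /inversion (sep_trans 1 t) // sep_simple //; congr (_ (+) _).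
by rewrite -[RHS](sepJ t) ?tV //; [rewrite !mulgA mulg1 tt mul1g -!mulgA tt mulg1|
   rewrite -{2}tV; apply: reflJ].
Qed.

(** The strong exchange condition: multiplying by [r] deletes one letter. It is the first letter [t]
    if [r = t]; otherwise [t * r * t] is an inversion of the product of the remaining letters, and
    the deletion takes place there. *)
Lemma exchange (ts : seq W) r : (forall t, t \in ts -> S t) -> refl r ->
  inversion (\prod_(t <- ts) t) r -> exists ts',
    [/\ forall t, t \in ts' -> S t, (size ts').+1 = size ts &
        \prod_(t <- ts') t = r * \prod_(t <- ts) t].
Proof.
elim: ts r => [|t ts IH] r Sts rr; first by rewrite big_nil inversion1.
have St : S t by apply: Sts; rewrite inE eqxx.
have {}Sts u : u \in ts -> S u by move=> uts; apply: Sts; rewrite inE uts orbT.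
rewrite big_cons inversion_mull //; case: eqP => [-> _|_ /=].
  by exists ts; rewrite mulgA mulSS // mul1g.
have tV := inv_simple St.
have rr' : refl (t * r * t) by rewrite -{2}tV; apply: reflJ.
case/(IH _ Sts rr')=> ts' [Sts' szts' prts'].
exists (t :: ts'); split=> /=; last by rewrite big_cons prts' !mulgA mulSS ?mul1g.
  by move=> u; rewrite inE => /predU1P[->|/Sts'].
by rewrite szts'.
Qed.

Definition minimal_word (w : seq W) := (forall s, s \in w -> S s) /\
  forall w', (forall s, s \in w' -> S s) ->
    \prod_(s <- w') s = \prod_(s <- w) s -> (size w <= size w')%N.

Lemma minimal_word_cons s w : minimal_word (s :: w) -> minimal_word w.
Proof.
case=> Ssw minw; split=> [t tw|w' Sw' ww']; first by apply: Ssw; rewrite inE tw orbT.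
have := minw (s :: w'); rewrite !big_cons ww' /= ltnS; apply=> // t.
by rewrite inE => /predU1P[->|/Sw' //]; apply: Ssw; rewrite inE eqxx.
Qed.

(** The positive side of each wall is taken to be the side away from the identity alcove. *)
Definition folds r d := inversion d r : Prop.

(* Folding a gallery on the right commutes with folding it on the left; this is
   the associativity of the Hecke product in disguise. *)
Lemma reach_mul_simple w u t y : (forall s, s \in w -> S s) -> S t ->
  (reach folds w (t * u) y \/ inversion u t /\ reach folds w u y) <->
  exists2 z, reach folds w u z & y = t * z \/ inversion z t /\ y = z.
Proof.
move=> Sw St; elim: w u Sw => [|s w IH] u Sw /=.
  by split=> [yE|[z -> //]]; exists u.
have Ss : S s by apply: Sw; rewrite inE eqxx.
have {}Sw v : v \in w -> S v by move=> vw; apply: Sw; rewrite inE vw orbT.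
have tV := inv_simple St; have rt := refl_S St.
have rs : refl (u * s * u^-1) := reflJ u (refl_S Ss).
have splitR (P Q : W -> Prop) (c : Prop) :
    (exists2 z, P z \/ c /\ Q z & y = t * z \/ inversion z t /\ y = z) <->
    (exists2 z, P z & y = t * z \/ inversion z t /\ y = z) \/
    c /\ (exists2 z, Q z & y = t * z \/ inversion z t /\ y = z).
  split; first by case=> z [Pz|[cz Qz]] yz; [left; exists z|right; split=> //; exists z].
  by case=> [[z Pz yz]|[cz [z Qz yz]]]; exists z => //; [left|right].
rewrite splitR -!IH // /folds -mulgA [inversion (u * s) t]inversion_mulr //.
have -> : inversion (t * u) (t * (u * s) * (t * u)^-1) =
          (t == u * s * u^-1) (+) inversion u (u * s * u^-1).
  have -> : t * (u * s) * (t * u)^-1 = t * (u * s * u^-1) * t^-1.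
    by rewrite invgM !mulgA.
  rewrite inversion_mull //; last exact: reflJ.
  rewrite tV; move: (u * s * u^-1) => c.
  have tcK d : t * (t * d * t) * t = d.
    by rewrite !mulgA mulSS // mul1g -mulgA mulSS // mulg1.
  rewrite tcK; congr (_ (+) _); apply/eqP/eqP => [e|<-].
    by rewrite -(tcK c) e mulSS // mul1g.
  by rewrite mulSS // mul1g.
(* Away from the wall of [t], the left and right conditions do not influence each other and both
   sides list the same alternatives. On that wall [u * s = t * u], and crossing it negates whether
   [t] is an inversion; a case distinction on this finishes. *)
case: (eqVneq t (u * s * u^-1)) => [tE|_] /=; last by tauto.
rewrite -tE; have -> : u * s = t * u by rewrite tE mulgVK.
by rewrite mulgA mulSS // mul1g; case: inversion => /=; tauto.
Qed.

(** No fold is ever allowed here: at the product of [v] it would let [exchange] drop a letter of [v]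
    while absorbing the next letter [s], giving a word for the same element that is shorter by
    two. *)
Lemma reach_minimal_word v w y : minimal_word (v ++ w) ->
  reach folds w (\prod_(t <- v) t) y <-> y = \prod_(t <- v ++ w) t.
Proof.
elim: w v => [|s w IH] v; first by rewrite cats0.
rewrite -cat_rcons => minw; have := IH _ minw; rewrite -cats1 big_cat big_seq1 /= => ->.
split=> [[//|[fv _]]|]; last by left.
have Sv t : t \in v -> S t.
  by move=> tv; apply: minw.1; rewrite mem_cat mem_rcons inE tv orbT.
have Ss : S s by apply: minw.1; rewrite mem_cat mem_rcons inE eqxx.
have [v' [Sv' szv' prv']] := exchange Sv (reflJ _ (refl_S Ss)) fv.
have := minw.2 (v' ++ w); rewrite !size_cat size_rcons -szv' => /(_ _ _)/wrap[].
- by move=> t; rewrite mem_cat => /orP[/Sv' //|tw]; apply: minw.1; rewrite mem_cat tw orbT.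
- by rewrite !big_cat /= prv' -cats1 big_cat big_seq1 /= mulgVK.
by move=> h; exfalso; move: h; apply/negP; rewrite -ltnNge ltn_add2r.
Qed.

(** Induction on a minimal word of the start [u]. From [1] only the product of the word is reached;
    each further letter on the left of [u] changes the reached set by a rule in which the type of
    the gallery no longer occurs. *)
Lemma reach_unique w w' u y : minimal_word w -> minimal_word w' ->
  \prod_(s <- w) s = \prod_(s <- w') s ->
  (exists2 ts, minimal_word ts & \prod_(t <- ts) t = u) ->
  reach folds w u y <-> reach folds w' u y.
Proof.
move=> minw minw' ww' [ts mints <-] {u}.
elim: ts mints y => [|t ts IH] mints y.
  have reach1 v : minimal_word v -> reach folds v 1 y <-> y = \prod_(s <- v) s.
    by move=> minv; have := @reach_minimal_word [::] v y minv; rewrite big_nil.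
  by rewrite big_nil !reach1 // ww'.
have mints' := minimal_word_cons mints.
have St : S t by apply: mints.1; rewrite inE eqxx.
(* The second alternative in [reach_mul_simple] would make [t] an inversion of the product of [ts],
   against the minimality of [t :: ts]. *)
have drop_fold v : minimal_word v -> reach folds v (\prod_(t <- t :: ts) t) y <->
    exists2 z, reach folds v (\prod_(t <- ts) t) z & y = t * z \/ inversion z t /\ y = z.
  move=> minv; rewrite -reach_mul_simple //; last by case: minv.
  rewrite big_cons; split=> [|[//|[fold _]]]; first by left.
  have Sts v' : v' \in ts -> S v' by case: mints' => + _; apply.
  have [ts' [Sts' szts' prts']] := exchange Sts (refl_S St) fold.
  have := mints.2 ts' Sts'; rewrite big_cons prts' => /(_ erefl) /=.
  by rewrite -szts' => h; exfalso; move: h; apply/negP; rewrite -ltnNge ltnS ltnW.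
rewrite !drop_fold //.
by split=> -[z rz yz]; exists z => //; apply/IH.
Qed.

End Separation.

Local Open Scope classical_set_scope.
Local Open Scope ring_scope.

(** Sign changes add modulo 2; this becomes the additivity of separation by a wall. *)
Lemma mulr_lt0_trans (R : realDomainType) (a b c : R) : a != 0 -> b != 0 -> c != 0 ->
  (a * c < 0) = (a * b < 0) (+) (b * c < 0).
Proof.
move=> a0 b0 c0; rewrite !neq_lt in a0 b0 c0.
by case/orP: a0 => a0; case/orP: b0 => b0; case/orP: c0 => c0;
  rewrite ?(nmulr_rlt0 _ a0) ?(pmulr_rlt0 _ a0) ?(nmulr_rlt0 _ b0) ?(pmulr_rlt0 _ b0)
    ?a0 ?b0 ?c0 ?ltNge ?(ltW b0) ?(ltW c0).
Qed.

(** * Euclidean geometry: reflections, half-spaces, components, translations *)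

Section EuclideanGeometry.
Variables (R : realType) (n : nat).
Local Notation E := 'rV[R]_n.
Implicit Types (a u v p q : E) (c d : R) (f g : E -> E) (C D H : set E).

Lemma dotpC u v : dotp u v = dotp v u.
Proof. by apply: eq_bigr => i _; rewrite mulrC. Qed.

Lemma dotpDr a u v : dotp a (u + v) = dotp a u + dotp a v.
Proof. by rewrite -big_split; apply: eq_bigr => i _; rewrite !mxE mulrDr. Qed.

Lemma dotpZr c a v : dotp a (c *: v) = c * dotp a v.
Proof. by rewrite mulr_sumr; apply: eq_bigr => i _; rewrite !mxE mulrCA. Qed.

Lemma dotpNr a v : dotp a (- v) = - dotp a v.
Proof. by rewrite -scaleN1r dotpZr mulN1r. Qed.

Lemma dotpBr a u v : dotp a (u - v) = dotp a u - dotp a v.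
Proof. by rewrite dotpDr dotpNr. Qed.

Lemma dotpDl a u v : dotp (u + v) a = dotp u a + dotp v a.
Proof. by rewrite !(dotpC _ a) dotpDr. Qed.

Lemma dotpZl c a v : dotp (c *: v) a = c * dotp v a.
Proof. by rewrite !(dotpC _ a) dotpZr. Qed.

Lemma dotpNl a v : dotp (- v) a = - dotp v a.
Proof. by rewrite !(dotpC _ a) dotpNr. Qed.

Lemma dotpBl a u v : dotp (u - v) a = dotp u a - dotp v a.
Proof. by rewrite !(dotpC _ a) dotpBr. Qed.

Definition dotpE := (dotpDl, dotpDr, dotpBl, dotpBr, dotpNl, dotpNr, dotpZl, dotpZr).

Lemma dotp_ge0 v : 0 <= dotp v v.
Proof. by apply: sumr_ge0 => i _; rewrite -expr2 sqr_ge0. Qed.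

Lemma sqr_coord_le v i : v 0 i ^+ 2 <= dotp v v.
Proof.
rewrite /dotp (bigD1 i) //= -expr2 lerDl.
by apply: sumr_ge0 => j _; rewrite -expr2 sqr_ge0.
Qed.

Lemma dotp_eq0 v : dotp v v = 0 -> v = 0.
Proof.
move=> v0; apply/rowP => i; rewrite mxE; apply/eqP; rewrite -sqrf_eq0 eq_le sqr_ge0.
by rewrite -v0 sqr_coord_le.
Qed.

Lemma dotp_gt0 v : v != 0 -> 0 < dotp v v.
Proof.
move=> v0; rewrite lt_neqAle dotp_ge0 andbT eq_sym.
by apply: contraNneq v0 => /dotp_eq0 ->.
Qed.

Definition dist2 u v := dotp (u - v) (u - v).

Lemma dist2_ge0 u v : 0 <= dist2 u v. Proof. exact: dotp_ge0. Qed.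

Definition affine_isometry f := exists M b,
  (forall u v, dotp (u *m M) (v *m M) = dotp u v) /\ forall v, f v = v *m M + b.

Lemma affine_isometry_id : affine_isometry id.
Proof.
by exists 1%:M, 0; split=> [u v|v]; rewrite !mulmx1 // addr0.
Qed.

Lemma affine_isometry_comp f g :
  affine_isometry f -> affine_isometry g -> affine_isometry (f \o g).
Proof.
move=> [M [b [MM fE]]] [N [d [NN gE]]]; exists (N *m M), (d *m M + b).
by split=> [u v|v /=]; rewrite ?mulmxA ?MM ?NN // fE gE mulmxDl addrA.
Qed.

(* Normal vectors have squared length 2, so that no denominator occurs in the
   formula of the reflection. *)
Definition reflection_in a c f :=
  dotp a a = 2 /\ forall v, f v = v - (dotp a v - c) *: a.

Lemma orthogonal_reflection_in f :
  orthogonal_reflection f -> exists a c, reflection_in a c f.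
Proof.
move=> [a [c [a0 fE]]]; have aa := dotp_gt0 a0.
pose k := Num.sqrt (2 / dotp a a); have kk : k * k = 2 / dotp a a.
  by rewrite -expr2 sqr_sqrtr // divr_ge0 // ltW.
exists (k *: a), (k * c); split=> [|v].
  by rewrite !dotpE mulrA kk divfK // gt_eqF.
rewrite fE dotpZl -mulrBr scalerA [in RHS]mulrAC kk.
by congr (_ - _ *: _); rewrite mulrAC.
Qed.

Lemma reflection_neq0 a c f : reflection_in a c f -> a != 0.
Proof.
move=> [aa _]; apply/eqP => a0; move: aa; rewrite a0 -(scale0r 0) dotpZl mul0r.
by move/eqP; rewrite eq_sym pnatr_eq0.
Qed.

Lemma reflection_affine_isometry a c f : reflection_in a c f -> affine_isometry f.
Proof.
move=> [aa fE]; pose M := 1%:M - a^T *m a.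
have ME v : v *m M = v - dotp a v *: a.
  rewrite mulmxBr mulmx1 mulmxA; congr (_ - _).
  rewrite [v *m _]mx11_scalar mul_scalar_mx; congr (_ *: _).
  by rewrite mxE; apply: eq_bigr => i _; rewrite mxE mulrC.
exists M, (c *: a); split=> [u v|v].
  by rewrite !ME !dotpE aa (dotpC u a); ring.
by rewrite ME fE scalerBl opprB addrCA addrC.
Qed.

Lemma reflection_conj a c f g f' : affine_isometry g ->
    (forall v, exists u, g u = v) -> (forall v, f' (g v) = g (f v)) ->
  reflection_in a c f -> exists a' c', reflection_in a' c' f'.
Proof.
move=> [M [b [MM gE]]] gsurj f'g [aa fE].
exists (a *m M), (c + dotp (a *m M) b); split=> [|v]; first by rewrite MM.
have [u <-] := gsurj v; rewrite f'g !gE fE mulmxBl -scalemxAl dotpDr MM.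
by rewrite addrAC; congr (_ - _ *: _); ring.
Qed.

Lemma reflection_fixed a c f : reflection_in a c f ->
  [set v | f v = v] = [set v | dotp a v = c].
Proof.
move=> fR; have [_ fE] := fR; apply/seteqP; split=> v /=; rewrite fE => vE.
  apply/eqP; rewrite -subr_eq0; move/eqP: vE.
  by rewrite -subr_eq0 addrAC subrr add0r oppr_eq0 scaler_eq0
     (negPf (reflection_neq0 fR)) orbF.
by rewrite vE subrr scale0r subr0.
Qed.

Lemma reflection_opp a c f v : reflection_in a c f ->
  dotp a (f v) - c = - (dotp a v - c).
Proof. by move=> [aa ->]; rewrite !dotpE aa; ring. Qed.

Lemma reflectionK a c f v : reflection_in a c f -> f (f v) = v.
Proof.
move=> fR; rewrite (fR.2 (f v)) (reflection_opp _ fR) fR.2.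
by rewrite scaleNr opprK subrK.
Qed.

(** Expresses a product of two signed heights by distances alone, hence in a form that isometries
    preserve and that does not depend on the sign of the normal. *)
Lemma dist2_reflection a c f u v : reflection_in a c f ->
  dist2 u (f v) = dist2 u v + 2 * ((dotp a u - c) * (dotp a v - c)).
Proof.
move=> [aa fE]; rewrite /dist2 fE opprB addrCA !dotpE aa.
by rewrite !(dotpC _ a) (dotpC v u); ring.
Qed.

Lemma hyperplane_eq a c a' c' : a != 0 -> a' != 0 ->
    [set v | dotp a v = c] = [set v | dotp a' v = c'] ->
  exists2 k, k != 0 & a' = k *: a /\ c' = k * c.
Proof.
move=> a0 a'0 HH'; have aa := lt0r_neq0 (dotp_gt0 a0).
pose v0 := (c / dotp a a) *: a; pose k := dotp a' a / dotp a a.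
have HH v : dotp a v = c -> dotp a' v = c'.
  by move=> vH; have : [set v | dotp a' v = c'] v by rewrite -HH'.
have av0 : dotp a v0 = c by rewrite dotpZr divfK.
have c'E : c' = k * c by rewrite -(HH _ av0) dotpZr /k; ring.
(* The part of [a'] orthogonal to [a] is a direction inside the first hyperplane, hence inside the
   second one; being orthogonal to both normals, it is orthogonal to itself and vanishes. *)
have au : dotp a (a' - k *: a) = 0.
  by rewrite dotpBr dotpZr /k divfK // dotpC subrr.
have a'u : dotp a' (a' - k *: a) = 0.
  have := HH (v0 + (a' - k *: a)); rewrite !(dotpDr _ v0) au addr0 (HH _ av0) => /(_ av0).
  by rewrite -[RHS]addr0 => /addrI.
have a'E : a' = k *: a.
  by apply/eqP; rewrite -subr_eq0; apply/eqP/dotp_eq0; rewrite dotpBl dotpZl a'u au; ring.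
exists k => //; apply: contraNneq a'0 => k0; by rewrite a'E k0 scale0r.
Qed.

Lemma reflection_eq a c f a' c' f' : reflection_in a c f -> reflection_in a' c' f' ->
  [set v | f v = v] = [set v | f' v = v] -> f =1 f'.
Proof.
move=> fR f'R; rewrite (reflection_fixed fR) (reflection_fixed f'R).
case/(hyperplane_eq (reflection_neq0 fR) (reflection_neq0 f'R))=> k k0 [a'E c'E] v.
have := f'R.1; rewrite a'E !dotpE fR.1 => kk; have {}kk : k * k = 1 by lra.
by rewrite fR.2 f'R.2 a'E c'E scalerA dotpZl -mulrBr mulrAC kk mul1r.
Qed.

Lemma half_space_cases a c H D : a != 0 -> H = [set v | dotp a v = c] ->
  half_space H D -> D = [set v | c <= dotp a v] \/ D = [set v | dotp a v <= c].
Proof.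
move=> a0 HE [a' [c' [a'0 HE' ->]]].
have [k k0 [-> ->]] := hyperplane_eq a0 a'0 (etrans (esym HE) HE').
have [kp|kn] : 0 < k \/ k < 0 by move: k0; rewrite neq_lt orbC => /orP.
  by left; apply/seteqP; split=> v /=; rewrite dotpZl ler_pM2l.
by right; apply/seteqP; split=> v /=; rewrite dotpZl ler_nM2l.
Qed.

Lemma half_space_ge a c : a != 0 ->
  half_space [set v | dotp a v = c] [set v | c <= dotp a v].
Proof. by move=> a0; exists a, c. Qed.

Lemma half_space_le a c : a != 0 ->
  half_space [set v | dotp a v = c] [set v | dotp a v <= c].
Proof.
move=> a0; exists (- a), (- c); split; first by rewrite oppr_eq0.
  by apply/seteqP; split=> v /=; rewrite dotpNl; [move=> ->|move/oppr_inj].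
by apply/seteqP; split=> v /=; rewrite dotpNl lerN2.
Qed.

Lemma continuous_dotp a : continuous (dotp a).
Proof.
suff sum_cont (r : seq 'I_n) : continuous (fun v : E => \sum_(i <- r) a 0 i * v 0 i).
  exact: sum_cont.
elim: r => [|i r IH].
  rewrite (_ : (fun _ => _) = cst 0); first exact: cst_continuous.
  by apply/funext => v; rewrite big_nil.
rewrite (_ : (fun _ => _) =
  (fun v => a 0 i * v 0 i) \+ (fun v => \sum_(j <- r) a 0 j * v 0 j)).
  move=> v; apply: continuousD; last exact: IH.
  by apply: continuousM; [exact: cst_continuous|exact: coord_continuous].
by apply/funext => v; rewrite big_cons.
Qed.

(** The image of [C] under the linear form is an interval that misses [c]. *)
Lemma connected_dotp C a c u v : connected C ->
  (forall w, C w -> dotp a w != c) -> C u -> C v ->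
  0 < (dotp a u - c) * (dotp a v - c).
Proof.
move=> cC CH; wlog uv : u v / dotp a u <= dotp a v.
  by move=> W Cu Cv; case: (leP (dotp a u) (dotp a v)) => [|/ltW] uv;
     [|rewrite mulrC]; apply: W.
move=> Cu Cv; have iC : is_interval (dotp a @` C).
  apply/connected_intervalP/connected_continuous_connected => //.
  exact/continuous_subspaceT/continuous_dotp.
have uc := CH _ Cu; have vc := CH _ Cv.
case: (ltgtP (dotp a u) c) uc => // uc _; case: (ltgtP (dotp a v) c) vc => // vc _.
- by rewrite nmulr_rgt0 subr_lt0.
- have [|w Cw wc] := iC _ _ (imageP (dotp a) Cu) (imageP (dotp a) Cv) c.
    by rewrite !ltW.
  by have := CH _ Cw; rewrite wc eqxx.
- lra.
- by rewrite pmulr_rgt0 subr_gt0.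
Qed.

Lemma segment_component C u v :
  (forall t, 0 <= t <= 1 -> C (u + t *: (v - u))) -> connected_component C u v.
Proof.
move=> CS; pose h (t : R) := u + t *: (v - u).
exists (h @` `[0, 1]); last by exists 1; [rewrite /= in_itv /= lexx ler01|rewrite /h scale1r addrC subrK].
split; first by exists 0; [rewrite /= in_itv /= lexx ler01|rewrite /h scale0r addr0].
  by move=> _ [t /= t01 <-]; apply: CS; rewrite in_itv /= in t01.
apply: connected_continuous_connected; first exact: segment_connected.
apply: continuous_subspaceT => t; apply: cvgD; first exact: cvg_cst.
by apply: cvgZr_tmp; exact: cvg_id.
Qed.

Lemma bounded_dist2 C q : bounded_set C -> exists B, forall v, C v -> dist2 v q < B.
Proof.
case=> M [Mreal CM]; pose N := `|M| + 1.
have CN v i : C v -> `|v 0 i| <= N.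
  move=> Cv; apply: le_trans (CM N _ v Cv).
    rewrite [leRHS]/Num.Def.normr /= mx_normrE; apply/bigmax_geP; right => /=.
    by exists (0, i).
  by rewrite /N (le_lt_trans (ler_norm M)) // ltrDl.
exists (\sum_(i < n) (N + `|q 0 i|) ^+ 2 + 1) => v Cv.
rewrite ltr_pwDr // /dist2 /dotp; apply: ler_sum => i _; rewrite -expr2 !mxE.
have N0 : 0 <= N by rewrite addr_ge0.
rewrite -real_normK ?num_real // lerXn2r ?nnegrE ?addr_ge0 //.
by apply: le_trans (ler_normB _ _) _; rewrite lerD2r CN.
Qed.

(** Neighbourhoods come from the sup norm, and every coordinate is bounded by the Euclidean length;
    the radius is squared because [dist2] is. *)
Lemma nbhs_dist2 q (U : set E) : nbhs q U ->
  exists2 e, 0 < e & forall v, dist2 q v < e -> U v.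
Proof.
case/nbhs_ballP=> e e0 eU; exists (e ^+ 2); first exact: exprn_gt0.
move=> v qv; apply: eU; split=> // i j; rewrite (ord1 i) /ball /=.
have e0' : 0 <= e := ltW e0.
rewrite -(ltr_pXn2r (n := 2)) ?nnegrE // real_normK ?num_real //.
by apply: le_lt_trans qv; have := sqr_coord_le (q - v) j; rewrite !mxE.
Qed.

Lemma dotp_le_norm a v : `|dotp a v| <= (dotp a a + dotp v v) / 2.
Proof.
have := dotp_ge0 (a + v); have := dotp_ge0 (a - v).
by rewrite !dotpE (dotpC v a) ler_norml => h1 h2; apply/andP; split; lra.
Qed.

Lemma translateE (u : E) (B : set E) v : translate u B v <-> B (v - u).
Proof.
split=> [[w Bw <-]|Bv]; first by rewrite addrK.
by exists (v - u) => //; rewrite subrK.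
Qed.

Lemma translateK (u : E) (B : set E) : translate (- u) (translate u B) = B.
Proof.
by apply/seteqP; split=> v; rewrite !translateE opprK addrK.
Qed.

Lemma continuous_shift (u : E) : continuous (fun v : E => v + u).
Proof.
move=> v; apply: (@continuousD _ _ _ (fun x : E => x) (cst u)); first exact: cvg_id.
exact: cst_continuous.
Qed.

Lemma translate_closure (u : E) (B : set E) :
  translate u (closure B) = closure (translate u B).
Proof.
apply/seteqP; split=> v.
  move/translateE=> Bv N vN.
  have [w [Bw Nw]] : B `&` (fun v => v + u) @^-1` N !=set0.
    apply: Bv; apply: (@continuous_shift u (v - u)).
    by rewrite subrK.
  by exists (w + u); split=> //; exists w.
move=> Bv; apply/translateE => N vN.
have [w [/translateE Bw Nw]] : translate u B `&` (fun v => v - u) @^-1` N !=set0.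
  by apply: Bv; apply: (@continuous_shift (- u) v).
by exists (w - u).
Qed.

Lemma translate_component (u : E) (B : set E) v :
  translate u (connected_component B v) = connected_component (translate u B) (v + u).
Proof.
have sub (w x : E) (D : set E) :
    translate w (connected_component D x) `<=` connected_component (translate w D) (x + w).
  move=> _ [y [F [Fx FD cF] Fy] <-]; exists (translate w F); last by exists y.
  split; first by exists x.
    by move=> _ [z Fz <-]; exists z => //; exact: FD.
  apply: connected_continuous_connected => //.
  exact/continuous_subspaceT/continuous_shift.
apply/seteqP; split; first exact: sub.
move=> w Bw; apply/translateE.
have := sub (- u) (v + u) (translate u B) (w - u).
by rewrite translateK addrK; apply; exists w.
Qed.

End EuclideanGeometry.

(** * Walls, heights and separation in the Euclidean realization *)

Section Realization.
Variables (R : realType) (n : nat) (W : groupType) (S : set W).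
Variable A : affine_realization R n S.
Local Notation E := 'rV[R]_n.
Local Notation "x • v" := (act A x v) (at level 40, v at next level).
Local Notation Hyps := (hyperplanes S (act A)).
Local Notation refl := (reflections S).
Implicit Types (x y g r s : W) (u v p q : E).

Hypothesis hWS : coxeter_system S.

Lemma actK g v : g^-1%g • (g • v) = v.
Proof. by rewrite -actM mulVg act1. Qed.

Lemma actKV g v : g • (g^-1%g • v) = v.
Proof. by rewrite -actM mulgV act1. Qed.

Lemma act_inj g u v : g • u = g • v -> u = v.
Proof. by move=> e; rewrite -(actK g u) e actK. Qed.

Lemma act_eq g g' : (forall v, g • v = g' • v) -> g = g'.
Proof.
move=> gg'; have : (g'^-1 * g)%g = 1%g.
  by apply: (@act_faithful _ _ _ _ A) => v; rewrite actM gg' actK.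
by move=> e; rewrite -[LHS](mulVKg g') e mulg1.
Qed.

(** The group is generated by elements acting as reflections, which gives affinity directly. *)
Lemma act_affine_isometry g : affine_isometry (act A g).
Proof.
have [_ gen _] := hWS; have [w [Sw <-]] := gen g.
elim: w Sw => [|s w IH] Sw.
  rewrite big_nil (_ : act A 1%g = id); last by apply/funext => v; rewrite act1.
  exact: affine_isometry_id.
rewrite big_cons (_ : act A _ = act A s \o act A (\prod_(t <- w) t)%g); last first.
  by apply/funext => v; rewrite actM.
apply: affine_isometry_comp; last by apply: IH => t tw; apply: Sw; rewrite inE tw orbT.
have /orthogonal_reflection_in[a [c]] : orthogonal_reflection (act A s).
  by apply: act_reflection; apply: Sw; rewrite inE eqxx.
exact: reflection_affine_isometry.
Qed.

Lemma act_dist2 g u v : dist2 (g • u) (g • v) = dist2 u v.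
Proof. exact: (act_isometry A). Qed.

Lemma refl_conj g r : refl r -> refl (g * r * g^-1)%g.
Proof.
by case=> x [s [Ss ->]]; exists (g * x)%g, s; rewrite invgM !mulgA.
Qed.

Lemma refl_simple s : S s -> refl s.
Proof. by move=> Ss; exists 1%g, s; rewrite mul1g invg1 mulg1. Qed.

Lemma act_refl r : refl r -> exists a c, reflection_in a c (act A r).
Proof.
case=> x [s [Ss ->]].
have [a [c sR]] := orthogonal_reflection_in (act_reflection A Ss).
apply: reflection_conj (act_affine_isometry x) _ _ sR => v.
  by exists (x^-1%g • v); rewrite actKV.
by rewrite -!actM mulgVK.
Qed.

(** An equation of the wall of [r] with normal of squared length 2; its sign is an arbitrary choice.
    The default [(0, 0)] is taken when [r] does not act as a reflection. *)
Definition equation r : E * R :=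
  xget (0, 0) [set ac | reflection_in ac.1 ac.2 (act A r)].
Definition normal r := (equation r).1.
Definition height r v := dotp (normal r) v - (equation r).2.

Lemma equationP r : refl r -> reflection_in (normal r) (equation r).2 (act A r).
Proof.
by case/act_refl=> a [c rR]; rewrite /normal /equation; case: xgetP => [ac -> //|/(_ (a, c))].
Qed.

Lemma normal_neq0 r : refl r -> normal r != 0.
Proof. by move/equationP/reflection_neq0. Qed.

Lemma fixed_pointsE r : refl r ->
  fixed_points (act A) r = [set v | dotp (normal r) v = (equation r).2].
Proof. by move/equationP/reflection_fixed. Qed.

Lemma fixed_height r v : refl r -> fixed_points (act A) r v <-> height r v = 0.
Proof.
move=> rr; rewrite fixed_pointsE // /height /=.
by split=> [->|/eqP]; rewrite ?subrr // subr_eq0 => /eqP.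
Qed.

Lemma heightD r u v : height r (u + v) = height r u + dotp (normal r) v.
Proof. by rewrite /height dotpDr; ring. Qed.

Lemma height_refl r v : refl r -> height r (r • v) = - height r v.
Proof. by move/equationP/reflection_opp; apply. Qed.

Lemma act_reflK r v : refl r -> r • (r • v) = v.
Proof. by move/equationP/reflectionK; apply. Qed.

Lemma refl_inv r : refl r -> r^-1%g = r.
Proof. by move=> rr; apply: act_eq => v; rewrite -{1}(act_reflK v rr) actK. Qed.

Lemma refl_inj r r' : refl r -> refl r' ->
  fixed_points (act A) r = fixed_points (act A) r' -> r = r'.
Proof.
move=> rr rr' e; apply: act_eq.
exact: reflection_eq (equationP rr) (equationP rr') e.
Qed.

Lemma height_prod r u v : refl r ->
  2 * (height r u * height r v) = dist2 u (r • v) - dist2 u v.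
Proof. by move=> rr; rewrite (dist2_reflection _ _ (equationP rr)) /height; ring. Qed.

(** The normals of [r] and of its conjugate are chosen independently, so single heights agree up to
    sign only. Their products agree, by the expression through distances. *)
Lemma height_conj g r u v : refl r ->
  height (g * r * g^-1)%g (g • u) * height (g * r * g^-1)%g (g • v) =
  height r u * height r v.
Proof.
move=> rr; have two0 : 2 != 0 :> R by rewrite pnatr_eq0.
apply: (mulfI two0); rewrite !height_prod //; last exact: refl_conj.
by rewrite !actM actK !act_dist2.
Qed.

Lemma fixed_points_conj g r v :
  fixed_points (act A) (g * r * g^-1)%g v <-> fixed_points (act A) r (g^-1%g • v).
Proof.
rewrite /fixed_points /= !actM; split=> [|e]; last by rewrite e actKV.
by move=> e; apply: (@act_inj g); rewrite e actKV.
Qed.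

Lemma complementP v : complement Hyps v <-> forall r, refl r -> height r v != 0.
Proof.
split=> [vH r rr|vH [H [r rr <-] /(fixed_height _ rr)/eqP]]; last exact/negP/vH.
apply/eqP => /(fixed_height v rr) rv; apply: vH.
by exists (fixed_points (act A) r) => //; exists r.
Qed.

Lemma complement_act g v : complement Hyps v -> complement Hyps (g • v).
Proof.
move/complementP=> vH; apply/complementP => r rr; apply/eqP.
have rr' := refl_conj g^-1%g rr.
move/(fixed_height _ rr) => gv; have /eqP := vH _ rr'; apply.
by apply/(fixed_height _ rr')/fixed_points_conj; rewrite invgK.
Qed.

Definition base_point : E := projT1 (cid2 (base_chamberP A)).

Lemma base_point_complement : complement Hyps base_point.
Proof. by rewrite /base_point; case: cid2. Qed.

Lemma base_chamberE :
  base_chamber A = connected_component (complement Hyps) base_point.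
Proof. by rewrite /base_point; case: cid2. Qed.

(** An interior point of the alcove of [g], not a barycentre: its side of a wall is the side of the
    whole alcove. *)
Definition centre g := g • base_point.

Lemma centre_height g r : refl r -> height r (centre g) != 0.
Proof.
by move=> rr; have /complementP/(_ r rr) := @complement_act g _ base_point_complement.
Qed.

Lemma continuous_height r : continuous (height r).
Proof.
move=> v; apply: (@continuousB _ _ _ (dotp (normal r)) (cst (equation r).2)).
  exact: continuous_dotp.
exact: cst_continuous.
Qed.

Lemma closed_height r (e : R) : closed [set v | 0 <= height r v * e].
Proof.
apply: (@closed_comp _ _ (fun v => height r v * e) [set x | 0 <= x]); last exact: closed_ge.
by move=> v _; apply: continuousM; [exact: continuous_height|exact: cst_continuous].
Qed.

(** The open chamber is connected and misses the wall, so the height keeps its sign on it; the weak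
    inequality passes to the closure. *)
Lemma base_chamber_height r v : refl r -> closure (base_chamber A) v ->
  0 <= height r v * height r base_point.
Proof.
move=> rr; have cl := @closed_height r (height r base_point).
suff : base_chamber A `<=` [set v | 0 <= height r v * height r base_point].
  by move/closureS/(_ v); rewrite -(iffLR (closure_id _) cl).
rewrite base_chamberE => w Cw /=; apply: ltW; apply: connected_dotp Cw _.
- exact: component_connected.
- move=> u /connected_component_sub/complementP/(_ _ rr).
  by rewrite /height subr_eq0.
- exact/connected_component_refl/base_point_complement.
Qed.

Lemma alcove_centre g : alcove A g (centre g).
Proof.
exists base_point => //; apply: subset_closure; rewrite base_chamberE.
exact/connected_component_refl/base_point_complement.
Qed.

Lemma alcove_height g r v : refl r -> alcove A g v ->
  0 <= height r v * height r (centre g).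
Proof.
move=> rr [u Cu <-]; have rr' := refl_conj g^-1%g rr.
have -> : r = (g * (g^-1 * r * g^-1^-1) * g^-1)%g.
  by rewrite invgK !mulgA mulgV mul1g mulgK.
by rewrite height_conj //; exact: base_chamber_height.
Qed.

Definition sep r x y := height r (centre x) * height r (centre y) < 0.

Lemma sep_trans r x y z : refl r -> sep r x z = sep r x y (+) sep r y z.
Proof. by move=> rr; apply: mulr_lt0_trans; exact: centre_height. Qed.

Lemma sep_conj g r x y : refl r ->
  sep (g * r * g^-1)%g (g * x)%g (g * y)%g = sep r x y.
Proof. by move=> rr; rewrite /sep /centre !actM height_conj. Qed.

(** A point [v] of the closed base chamber that lies on the wall of [s] and on no other is fixed by
    [s], so it belongs to both alcoves. For [r != s] both centres are then strictly on the side of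
    [v]. *)
Lemma sep_simple r s : refl r -> S s -> sep r 1%g s = (r == s).
Proof.
move=> rr Ss; have rs := refl_simple Ss.
have [->|rNs] := eqVneq.
  rewrite /sep /centre act1 height_refl // mulrN oppr_lt0 -expr2 exprn_even_gt0 //=.
  by rewrite -[base_point](act1 A) centre_height.
have [_ [v [Cv sv vP]]] : wall_of_chamber Hyps (base_chamber A) (fixed_points (act A) s).
  by apply/base_chamber_walls; exists s.
have rv : height r v != 0.
  apply: contra_neq rNs => /(fixed_height v rr) rv; apply: refl_inj => //.
  by apply: vP => //; exists r.
(* The sign at [centre s] with respect to [r] is the sign at [base_point] with respect to [r'],
   transported by [s]. *)
pose r' := (s * r * s^-1)%g; have rr' : refl r' := refl_conj s rr.
have r'v : height r' v != 0.
  apply/eqP => /(fixed_height v rr')/fixed_points_conj.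
  by rewrite refl_inv // sv => /(fixed_height v rr)/eqP; exact/negP.
have H x (rx : refl x) := base_chamber_height rx Cv.
have : 0 < height r v * height r base_point.
  rewrite lt_neqAle H // eq_sym mulf_neq0 // -[base_point](act1 A).
  exact: centre_height.
have : 0 < height r v * height r (centre s).
  have := H _ rr'; rewrite -(height_conj s) //.
  have -> : (s * r' * s^-1 = r)%g.
    have ss : (s * s = 1)%g by rewrite -{1}(refl_inv rs) mulVg.
    by rewrite /r' (refl_inv rs) !mulgA ss mul1g -mulgA ss mulg1.
  by rewrite (sv : s • v = v) => h; rewrite lt_neqAle h eq_sym mulf_neq0 ?centre_height.
rewrite /sep /centre act1; move: rv; rewrite neq_lt => /orP[] rv.
  rewrite !(nmulr_rgt0 _ rv) => sb b; apply/negbTE; rewrite -leNgt ltW // nmulr_rgt0 //.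
by rewrite !(pmulr_rgt0 _ rv) => sb b; apply/negbTE; rewrite -leNgt ltW // pmulr_rgt0.
Qed.


(** * The positive half-spaces of a direction *)

Section Direction.
Variables (phi : set (set E)) (t : W) (C0 : set E) (w0 u0 : E).
Hypothesis act_t : forall v, t • v = v + u0.
Let v0 : E := t • origin A.
Hypothesis w0_complement : complement (through Hyps v0) w0.
Hypothesis C0E : C0 = connected_component (complement (through Hyps v0)) w0.
Hypothesis phiE :
  phi = [set K | weyl_chamber A K /\ exists u, K = translate u (closure C0)].
(** A vector from the apex into the open chamber; the positive side of a wall will be the side
    towards which [d] points. *)
Let d : E := w0 - v0.

Lemma through_height v w r : refl r -> height r v = 0 ->
  complement (through Hyps v) w -> height r w != 0.
Proof.
move=> rr rv wv; apply/eqP => rw; apply: wv.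
exists (fixed_points (act A) r); last exact/fixed_height.
by split; [exists r|exact/fixed_height].
Qed.

(** The origin is special, so a parallel wall passes through it; conjugating by [t] moves that wall
    to [v0]. The factor is a sign because both normals have squared length 2. *)
Lemma parallel_through r : refl r -> exists r' k,
  [/\ refl r', k * k = 1, normal r' = k *: normal r & height r' v0 = 0].
Proof.
move=> rr; have [_ par] := origin_special A.
have [|_ [[r1 rr1 <-] r1o] [u]] := par (fixed_points (act A) r); first by exists r.
rewrite (fixed_pointsE rr) => parE.
pose r2 := (t * r1 * t^-1)%g; have rr2 : refl r2 := refl_conj t rr1.
have vE v : v = t^-1%g • v + u0 by rewrite -act_t actKV.
have r2E : fixed_points (act A) r2 =
    [set v | dotp (normal r) v = (equation r).2 + dotp (normal r) (u + u0)].
  apply/seteqP; split=> v.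
    move/fixed_points_conj; rewrite parE => /translateE /= h.
    by move: (vE v) h; move: (t^-1%g • v) => w -> /=; rewrite !dotpE => h; lra.
  rewrite /= => h; apply/fixed_points_conj; rewrite parE; apply/translateE => /=.
  by move: (vE v) h; move: (t^-1%g • v) => w ->; rewrite !dotpE => h; lra.
have r2v0 : height r2 v0 = 0.
  by apply/fixed_height => //; apply/fixed_points_conj; rewrite actK.
have := r2E; rewrite (fixed_pointsE rr2) => /esym.
case/(hyperplane_eq (normal_neq0 rr) (normal_neq0 rr2))=> k k0 [nE _].
exists r2, k; split=> //; have := (equationP rr2).1.
by rewrite nE !dotpE (equationP rr).1 => h; lra.
Qed.

Lemma direction_transverse r : refl r -> dotp (normal r) d != 0.
Proof.
move=> rr; have [r' [k [rr' kk nE r'v0]]] := parallel_through rr.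
have := through_height rr' r'v0 w0_complement.
have -> : height r' w0 = height r' v0 + dotp (normal r') d.
  by rewrite -heightD /d addrC subrK.
by rewrite r'v0 add0r nE dotpZl mulf_eq0 negb_or => /andP[].
Qed.

Lemma chamber_height r v : refl r -> closure C0 v ->
  0 <= dotp (normal r) (v - v0) * dotp (normal r) d.
Proof.
move=> rr; have [r' [k [rr' kk nE r'v0]]] := parallel_through rr.
have h'E w : height r' w = k * dotp (normal r) (w - v0).
  by rewrite -dotpZl -nE -[LHS]subr0 -{1}r'v0 /height dotpBr; ring.
have cl := @closed_height r' (height r' w0).
have sub : C0 `<=` [set v | 0 <= height r' v * height r' w0].
  rewrite C0E => w Cw /=; apply: ltW; apply: connected_dotp Cw _.
  - exact: component_connected.
  - move=> u /connected_component_sub/(through_height rr' r'v0).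
    by rewrite /height subr_eq0.
  - exact: connected_component_refl.
move/(closureS sub); rewrite -(iffLR (closure_id _) cl) /= !h'E -/d.
by rewrite mulrACA kk mul1r.
Qed.

(** On a wall through [v0] the height at [w0 + x *: d] is [1 + x] times the nonzero number
    [dotp (normal r) d], so the ray meets no such wall. *)
Lemma chamber_ray m : 0 <= m -> C0 (w0 + m *: d).
Proof.
move=> m0; rewrite C0E; apply: segment_component => l /andP[l0 _].
rewrite [w0 + m *: d]addrC addrK scalerA => -[_ [[r rr <-] rv0]].
move/(fixed_height _ rr); rewrite heightD dotpZr.
have -> : height r w0 = height r v0 + dotp (normal r) d.
  by rewrite -heightD /d addrC subrK.
rewrite (iffLR (fixed_height _ rr) rv0) add0r -[X in X + _]mul1r -mulrDl => /eqP.
rewrite mulf_eq0 (negPf (direction_transverse rr)) orbF => /eqP.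
by have := mulr_ge0 l0 m0; lra.
Qed.

(** A direction contains only translates that are themselves Weyl chambers; translations in [W]
    produce such translates, since they permute the walls. *)
Lemma weyl_chamber_translate g u : (forall v, g • v = v + u) ->
  weyl_chamber A (translate u (closure C0)).
Proof.
move=> gE; exists (g * t)%g, (translate u C0); split.
- by exists (u0 + u) => v; rewrite actM gE act_t addrA.
- exists (w0 + u); last first.
    rewrite C0E translate_component; congr connected_component.
    apply/seteqP; split=> v.
      move/translateE=> vH [_ [[r rr <-] rv0] rv]; apply: vH.
      have rr' := refl_conj g^-1%g rr.
      exists (fixed_points (act A) (g^-1 * r * g^-1^-1)%g).
        split; first by exists (g^-1 * r * g^-1^-1)%g.
        by apply/fixed_points_conj; rewrite invgK -actM.
      by apply/fixed_points_conj; rewrite invgK gE subrK.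
    move=> vH; apply/translateE => -[_ [[r rr <-] rv0] rv]; apply: vH.
    have rr' := refl_conj g rr.
    exists (fixed_points (act A) (g * r * g^-1)%g).
      split; first by exists (g * r * g^-1)%g.
      by apply/fixed_points_conj; rewrite actM actK.
    apply/fixed_points_conj; move: rv; congr (fixed_points _ _ _).
    by apply: (@act_inj g); rewrite actKV gE subrK.
  move=> [_ [[r rr <-] rv0] rv]; apply: w0_complement.
  have rr' := refl_conj g^-1%g rr.
  exists (fixed_points (act A) (g^-1 * r * g^-1^-1)%g).
    split; first by exists (g^-1 * r * g^-1^-1)%g.
    by apply/fixed_points_conj; rewrite invgK -actM.
  by apply/fixed_points_conj; rewrite invgK gE.
- exact: translate_closure.
Qed.

(** The opposite half-space contains no translate of the chamber, because a ray along [d] leaves it.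
    The positive one contains the chamber itself if [v0] is on that side, and otherwise its
    translate with apex at the mirror image of [v0]. *)
Lemma positive_half_spaceP r D : refl r ->
  positive_half_space phi (fixed_points (act A) r) D <->
  D = [set v | 0 <= height r v * dotp (normal r) d].
Proof.
move=> rr; set e := dotp (normal r) d.
have e0 : e != 0 := direction_transverse rr.
have half_pm : [set v | 0 <= height r v * e] = [set v | (equation r).2 <= dotp (normal r) v]
   /\ [set v | dotp (normal r) v <= (equation r).2] = [set v | height r v * e <= 0]
 \/ [set v | 0 <= height r v * e] = [set v | dotp (normal r) v <= (equation r).2]
   /\ [set v | (equation r).2 <= dotp (normal r) v] = [set v | height r v * e <= 0].
  move: e0; rewrite neq_lt => /orP[] e0; [right|left]; split; apply/seteqP; split=> v /=;
  by rewrite ?(nmulr_lge0 _ e0) ?(pmulr_lge0 _ e0) ?(nmulr_lle0 _ e0) ?(pmulr_lle0 _ e0)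
       /height ?subr_ge0 ?subr_le0.
have n0 := normal_neq0 rr.
split=> [[/(half_space_cases n0 (fixed_pointsE rr)) Dcases [K]]|->].
  have [//|->] : D = [set v | 0 <= height r v * e] \/ D = [set v | height r v * e <= 0].
    by case: half_pm => -[-> <-]; case: Dcases; auto.
  rewrite phiE => -[_ [u ->]] KD; exfalso.
  (* Chosen so that [m * e ^+ 2] exceeds the absolute value of [height r (w0 + u) * e]. *)
  pose m := `|height r (w0 + u)| / `|e| + 1.
  have m0 : 0 <= m by rewrite addr_ge0 // divr_ge0.
  have /KD/= : translate u (closure C0) ((w0 + m *: d) + u).
    by exists (w0 + m *: d) => //; exact/subset_closure/chamber_ray.
  rewrite addrAC heightD dotpZr -/e; apply/negP; rewrite -ltNge mulrDl -mulrA.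
  have ee : 0 < `|e| by rewrite normr_gt0.
  have -> : m * (e * e) = `|height r (w0 + u)| * `|e| + `|e| * `|e|.
    have -> : e * e = `|e| * `|e| by rewrite -!expr2 real_normK ?num_real.
    by rewrite /m; field; rewrite gt_eqF.
  have := lerNnormlW (lexx `|height r (w0 + u) * e|); rewrite normrM.
  by have := mulr_gt0 ee ee; lra.
split.
  rewrite fixed_pointsE //; case: half_pm => -[-> _];
  [exact: half_space_ge|exact: half_space_le].
rewrite phiE; have hE v : height r v = height r v0 + dotp (normal r) (v - v0).
  by rewrite -heightD addrC subrK.
case: (leP 0 (height r v0 * e)) => v0e.
  exists (closure C0); last first.
    by move=> v Cv /=; rewrite hE mulrDl addr_ge0 // chamber_height.
  have shift0 : translate 0 (closure C0) = closure C0.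
    by apply/seteqP; split=> v; rewrite translateE subr0.
  split; last by exists 0.
  by rewrite -shift0; apply: (@weyl_chamber_translate 1%g) => v; rewrite act1 addr0.
have [r' [k [rr' kk nE r'v0]]] := parallel_through rr.
have nn := (equationP rr).1.
pose u := - height r v0 *: normal r.
exists (translate u (closure C0)).
  split; last by exists u.
  (* The walls of [r] and [r'] are parallel, so [r * r'] is a translation; it
     moves [v0] to its mirror image in the wall of [r]. *)
  apply: (@weyl_chamber_translate (r * r')%g) => v.
  set x := dotp (normal r) (v - v0).
  have r'E : r' • v = v - x *: normal r.
    rewrite (equationP rr').2 -/(height r' v).
    have -> : height r' v = height r' v0 + dotp (normal r') (v - v0).
      by rewrite -heightD addrC subrK.
    by rewrite r'v0 add0r nE dotpZl scalerA mulrAC kk mul1r.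
  rewrite actM r'E (equationP rr).2 -/(height r _) heightD dotpNr dotpZr nn hE -/x.
  rewrite (_ : _ + _ - _ = height r v0 - x); last by ring.
  by rewrite scalerBl opprB addrA subrK /u scaleNr.
move=> _ [v Cv <-] /=; rewrite heightD hE dotpZr nn.
by have := chamber_height rr Cv; rewrite -/e; lra.
Qed.

End Direction.

Lemma direction_vector phi : direction A phi -> exists d : E,
  (forall r, refl r -> dotp (normal r) d != 0) /\
  (forall r D, refl r -> positive_half_space phi (fixed_points (act A) r) D <->
     D = [set v | 0 <= height r v * dotp (normal r) d]).
Proof.
move=> [_ [t [C [[u0 tE] [w0 w0H CE] ->]]] phiE].
exists (w0 - t • origin A); split=> [r|r D] rr.
  exact: direction_transverse tE w0H r rr.
exact: positive_half_spaceP tE w0H CE phiE r D rr.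
Qed.

Lemma half_space_height r (e : R) D : refl r -> e != 0 ->
  half_space (fixed_points (act A) r) D <->
  D = [set v | 0 <= height r v * e] \/ D = [set v | height r v * e <= 0].
Proof.
move=> rr e0; have n0 := normal_neq0 rr.
have e_sign : 0 < e \/ e < 0 by move: e0; rewrite neq_lt orbC => /orP.
have geE : [set v | (equation r).2 <= dotp (normal r) v] =
    if 0 < e then [set v | 0 <= height r v * e] else [set v | height r v * e <= 0].
  case: ifPn e_sign => [ep _|_ [//|en]]; apply/seteqP; split=> v /=;
  by rewrite ?(pmulr_lge0 _ ep) ?(nmulr_lle0 _ en) subr_ge0.
have leE : [set v | dotp (normal r) v <= (equation r).2] =
    if 0 < e then [set v | height r v * e <= 0] else [set v | 0 <= height r v * e].
  case: ifPn e_sign => [ep _|_ [//|en]]; apply/seteqP; split=> v /=;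
  by rewrite ?(pmulr_lle0 _ ep) ?(nmulr_lge0 _ en) subr_le0.
split=> [/(half_space_cases n0 (fixed_pointsE rr))|].
  by rewrite geE leE; case: ifP => _ []; auto.
have := half_space_ge (equation r).2 n0; have := half_space_le (equation r).2 n0.
by rewrite fixed_pointsE // geE leE; case: ifP => _ ? ? [->|->].
Qed.

Lemma half_space_height_neq r (e : R) g : refl r -> e != 0 ->
  [set v | 0 <= height r v * e] <> [set v | height r v * e <= 0].
Proof.
move=> rr e0 h; have n0 := normal_neq0 rr.
have eq0 v : height r v * e = 0.
  have [ge0|/ltW le0] := leP 0 (height r v * e); apply/eqP; rewrite eq_le.
    by have : [set v | 0 <= height r v * e] v by []; rewrite {1}h /= => ->.
  by have : [set v | height r v * e <= 0] v by []; rewrite -h /= => ->; rewrite le0.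
have /eqP := eq0 (centre g).
by rewrite mulf_eq0 (negPf (centre_height _ rr)) (negPf e0).
Qed.

Lemma separatesP r x y : refl r ->
  separates (fixed_points (act A) r) (alcove A x) (alcove A y) <-> sep r x y.
Proof.
move=> rr; pose e := height r (centre x); have e0 : e != 0 := centre_height x rr.
have ee : 0 < e * e by rewrite -expr2 exprn_even_gt0.
rewrite /sep mulrC -/e; split.
  move=> [D [D' [/(half_space_height _ rr e0) DE /(half_space_height _ rr e0) D'E DD' xD yD']]].
  have {}DE : D = [set v | 0 <= height r v * e].
    case: DE => // DE; have := xD _ (alcove_centre x).
    by rewrite DE /= -/e leNgt ee.
  have {}D'E : D' = [set v | height r v * e <= 0].
    by case: D'E => // D'E; case: DD'; rewrite DE.
  have := yD' _ (alcove_centre y); rewrite D'E /= => h.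
  by rewrite lt_neqAle h mulf_neq0 ?centre_height.
move=> ye; exists [set v | 0 <= height r v * e], [set v | height r v * e <= 0].
split.
- by apply/(half_space_height _ rr e0); left.
- by apply/(half_space_height _ rr e0); right.
- exact: (half_space_height_neq 1%g).
- by move=> v /(alcove_height rr).
- move=> v /(alcove_height rr) /= vy.
  have y0 : 0 < height r (centre y) * height r (centre y).
    by rewrite -expr2 exprn_even_gt0 ?centre_height.
  rewrite -(pmulr_lle0 _ y0).
  have -> : height r v * e * (height r (centre y) * height r (centre y)) =
    (height r v * height r (centre y)) * (height r (centre y) * e) by ring.
  by rewrite mulr_ge0_le0 // ltW.
Qed.

(** * Alcoves deep on the negative side of finitely many walls *)

Lemma base_point_distance : exists2 e : R, 0 < e &
  forall r, refl r -> e <= height r base_point ^+ 2.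
Proof.
have [U Uq finU] := hyperplanes_locally_finite A base_point.
have [F FE] := iffLR finite_fsetP finU.
have qC : nbhs base_point (\bigcap_(H in [set` F]) ~` H).
  apply: filter_bigI => H HF; have : [set` F] H by [].
  rewrite -FE => -[[r rr <-] _].
  have cl : closed (fixed_points (act A) r).
    rewrite (_ : fixed_points _ _ = height r @^-1` [set 0]).
      by apply: closed_comp; [move=> v _; exact: continuous_height|exact: closed_eq].
    by apply/seteqP; split=> v /=; [move/(fixed_height _ rr)|move=> h; apply/(fixed_height _ rr)].
  apply: open_nbhs_nbhs; split; first exact: closed_openC.
  move/(fixed_height _ rr)/eqP; apply/negP.
  by rewrite -[base_point](act1 A) centre_height.
have [e e0 eU] := nbhs_dist2 (filterI Uq qC).
exists e => // r rr; rewrite leNgt; apply/negP => he.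
(* The foot of the perpendicular on the wall; its squared distance is half the squared height, the
   normal having squared length 2. *)
pose v := base_point - (height r base_point / 2) *: normal r.
have nn := (equationP rr).1.
have rv : fixed_points (act A) r v.
  by apply/(fixed_height _ rr); rewrite heightD dotpNr dotpZr nn; field.
have [] := eU v.
  rewrite /dist2 /v opprB addrC subrK dotpZl dotpZr nn.
  apply: le_lt_trans he; have := sqr_ge0 (height r base_point); nra.
move=> Uv /(_ (fixed_points (act A) r)); apply=> //.
by rewrite -FE; split; [exists r|exists v].
Qed.

(* If [p] is far from the centre [x q], then the wall that the first half of the
   segment from [q] to [x^-1 p] meets separates the two points, and [p] is closer
   to the centre of the reflected alcove by an amount bounded below; so a nearly
   closest centre is within a fixed distance. *)
Lemma centre_dense : exists B : R, forall p, exists x, dist2 (centre x) p < B.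
Proof.
have [B0 CB0] := bounded_dist2 base_point (base_chamber_bounded A).
have [e e0 qe] := base_point_distance.
(* Factor 4 because the midpoint [m] below is at half the distance: it then has squared distance at
   least [B0] and is outside the base chamber. *)
exists (4 * B0) => p; pose X := [set dist2 (centre x) p | x in setT].
have infX : has_inf X.
  split; first by exists (dist2 (centre 1%g) p); exists 1%g.
  by exists 0 => _ [x _ <-]; exact: dist2_ge0.
have [_ [x _ <-] xinf] := inf_adherent e0 infX.
exists x; rewrite ltNge; apply/negP => farx.
pose p' := x^-1%g • p; pose q := base_point.
have qp' : dist2 (centre x) p = dist2 q p'.
  by rewrite -(act_dist2 x q p') actKV.
pose m := q + 2^-1 *: (p' - q).
have : ~ base_chamber A m.
  move/CB0; rewrite /m -/q /dist2 [q + _]addrC addrK dotpZl dotpZr; apply/negP.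
  by move: farx; rewrite -leNgt qp' /dist2 -opprB dotpNl dotpNr; lra.
rewrite base_chamberE => /(contra_not (@segment_component _ _ _ q m))/existsNP[l].
rewrite not_implyE => -[/andP[l0 l1] /contrapT[_ [r rr <-] /(fixed_height _ rr)]].
have -> : m - q = 2^-1 *: (p' - q) by rewrite /m addrC addKr.
rewrite scalerA heightD dotpZr => hl.
have hp' : height r p' = height r q + dotp (normal r) (p' - q).
  by rewrite -heightD addrC subrK.
have hq := qe r rr; rewrite -/q in hq.
have lD2 : 0 <= l * (1 - l) * dotp (normal r) (p' - q) ^+ 2.
  by rewrite mulr_ge0 ?sqr_ge0 // mulr_ge0 // subr_ge0.
(* The wall is met at parameter [l / 2], at most one half, so [p'] is at least as far beyond it as
   [q] is in front. Reflecting thus lowers the squared distance by at least [2 * e], while [x] is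
   within [e] of the infimum. *)
have qp'_le : height r q * height r p' <= - height r q ^+ 2.
  move: lD2 hl; rewrite hp'; move: (dotp _ _) (height r q) => D h lD2 hl.
  have -> : h = - (l * 2^-1 * D) by lra.
  lra.
have : inf X <= dist2 (centre (x * r)%g) p.
  by apply: ge_inf; [exact: infX.2|exists (x * r)%g].
have -> : dist2 (centre (x * r)%g) p = dist2 q p' + 2 * (height r q * height r p').
  rewrite -(dist2_reflection _ _ (equationP rr)) -(act_dist2 (x * r)%g q).
  by rewrite /centre !actM (act_reflK _ rr) actKV.
by move: xinf; rewrite qp'; lra.
Qed.

(** For large [l] the point [- l *: d] is far on the negative side of the listed walls, and some
    centre lies within a distance of it that does not depend on [l]. *)
Lemma deep_centre (d : E) (rs : seq W) :
  (forall r, r \in rs -> refl r /\ dotp (normal r) d != 0) ->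
  exists g, forall r, r \in rs -> height r (centre g) * dotp (normal r) d < 0.
Proof.
move=> rsP; have [B centreB] := centre_dense.
(* The term [1 + B / 2] bounds the change of height between that point and the centre, by
   [dotp_le_norm] with a normal of squared length 2. *)
pose bound r := (`|(equation r).2| + 1 + B / 2) / `|dotp (normal r) d|.
have [l lP] : exists l, forall r, r \in rs -> bound r < l.
  elim: rs {rsP} => [|r rs [l lP]]; first by exists 0.
  exists (Num.max l (bound r + 1)) => r'; rewrite inE lt_max => /predU1P[->|/lP->//].
  by rewrite ltrDl ltr01 orbT.
have [g gB] := centreB (- l *: d); exists g => r rrs; have [rr] := rsP r rrs.
have := lP r rrs; rewrite /bound; set e := dotp (normal r) d => le e0.
have ee : 0 < `|e| by rewrite normr_gt0.
rewrite ltr_pdivrMr // in le.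
pose w := centre g - - l *: d.
have nw : `|dotp (normal r) w| < 1 + B / 2.
  apply: le_lt_trans (dotp_le_norm _ _) _; rewrite (equationP rr).1.
  by have : dotp w w < B := gB; lra.
have -> : height r (centre g) = - (equation r).2 - l * e + dotp (normal r) w.
  by rewrite /w /height !dotpE -/e; ring.
have lt_e : `|- (equation r).2 + dotp (normal r) w| < l * `|e|.
  by apply: le_lt_trans (ler_normD _ _) _; rewrite normrN; lra.
move: e0; rewrite neq_lt => /orP[] en.
  move: lt_e; rewrite (ltr0_norm en) nmulr_llt0 // => /ltr_normlP[]; lra.
by move: lt_e; rewrite (gtr0_norm en) pmulr_llt0 // => /ltr_normlP[]; lra.
Qed.


Lemma alcove_half_space r g (e : R) : refl r -> e != 0 ->
  alcove A g `<=` [set v | 0 <= height r v * e] <-> 0 < height r (centre g) * e.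
Proof.
move=> rr e0; split=> [/(_ _ (alcove_centre g)) /= ge|gt v /(alcove_height rr) /= vg].
  by rewrite lt_neqAle eq_sym mulf_neq0 ?centre_height.
have g0 : 0 < height r (centre g) * height r (centre g).
  by rewrite -expr2 exprn_even_gt0 ?centre_height.
rewrite -(pmulr_lge0 _ g0).
have -> : height r v * e * (height r (centre g) * height r (centre g)) =
  (height r v * height r (centre g)) * (height r (centre g) * e) by ring.
by rewrite mulr_ge0 // ltW.
Qed.

(** * The valuation and how it changes across a panel *)

Section Oriented.
Variables (phi : set (set E)) (d : E).
Hypothesis d_transverse : forall r, refl r -> dotp (normal r) d != 0.
Hypothesis phi_d : forall r D, refl r ->
  positive_half_space phi (fixed_points (act A) r) D <->
  D = [set v | 0 <= height r v * dotp (normal r) d].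

Definition positive r c := 0 < height r (centre c) * dotp (normal r) d.

Lemma on_positive_sideP r c : refl r ->
  on_positive_side A phi (fixed_points (act A) r) c <-> positive r c.
Proof.
move=> rr; rewrite /positive -(alcove_half_space _ rr) ?d_transverse //.
by split=> [[D /(phi_d _ rr) ->]|cD] //; eexists; first exact/phi_d.
Qed.

Lemma on_negative_sideP r c : refl r ->
  on_negative_side A phi (fixed_points (act A) r) c <-> ~~ positive r c.
Proof.
move=> rr; have e0 := d_transverse rr; set e := dotp (normal r) d in e0 *.
have leE : [set v | height r v * e <= 0] = [set v | 0 <= height r v * - e].
  by apply/seteqP; split=> v /=; rewrite mulrN oppr_ge0.
have -> : ~~ positive r c = (0 < height r (centre c) * - e).
  rewrite /positive -leNgt mulrN oppr_gt0 lt_neqAle mulf_neq0 ?centre_height //.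
rewrite -(alcove_half_space _ rr) ?oppr_eq0 // -leE; split=> [|cD].
  move=> [D [/(half_space_height _ rr e0)[] -> [D' /(phi_d _ rr) ->]]] //.
exists [set v | height r v * e <= 0] => //; split.
  by apply/(half_space_height _ rr e0); right.
by eexists; [exact/phi_d|apply/nesym/(half_space_height_neq 1%g)].
Qed.

Definition sep_hyps (b : bool) c := [set fixed_points (act A) r |
  r in [set r | [/\ refl r, sep r 1%g c & positive r c = b]]].

Lemma valuationE c : valuation A phi c =
  #|` fset_set (sep_hyps true c)|%:Z - #|` fset_set (sep_hyps false c)|%:Z.
Proof.
have posE : [set H | separating A c H /\ on_positive_side A phi H c] = sep_hyps true c.
  apply/seteqP; split=> H.
    move=> [[[r rr <-] /(separatesP _ _ rr) rc] /(on_positive_sideP _ rr) rp].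
    by exists r => //; split=> //; rewrite /sep mulrC.
  move=> [r [rr rc rp] <-]; split; last exact/on_positive_sideP.
  by split; [exists r|apply/separatesP => //; rewrite /sep mulrC].
have negE : [set H | separating A c H /\ on_negative_side A phi H c] = sep_hyps false c.
  apply/seteqP; split=> H.
    move=> [[[r rr <-] /(separatesP _ _ rr) rc] /(on_negative_sideP _ rr) rp].
    by exists r => //; split=> //; [rewrite /sep mulrC|exact/negbTE].
  move=> [r [rr rc /negbT rp] <-]; split; last exact/on_negative_sideP.
  by split; [exists r|apply/separatesP => //; rewrite /sep mulrC].
by rewrite /valuation posE negE.
Qed.

Lemma positive_sep r x y : refl r -> positive r y = positive r x (+) sep r x y.
Proof.
move=> rr; have nz (a : R) : a != 0 -> (0 < a) = ~~ (a < 0).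
  by move=> a0; rewrite -leNgt le_eqVlt eq_sym (negPf a0).
have d0 := d_transverse rr.
rewrite /positive !nz ?mulf_neq0 ?centre_height //.
rewrite (@mulr_lt0_trans _ _ (height r (centre x))) ?centre_height //.
rewrite [height r (centre y) * height r (centre x)]mulrC.
by rewrite -/(sep r x y); case: (sep r x y); case: (height r (centre x) * _ < 0).
Qed.

Let sep_mulr r z s : refl r -> S s -> sep r z (z * s)%g = (r == (z * s * z^-1)%g).
Proof. exact: (sep_mulr refl_conj sep_conj sep_simple). Qed.

(** Every letter of a word for [c] adds at most one separating wall. Finiteness is essential, since
    [fset_set] sends infinite sets to the empty set. *)
Lemma finite_sep_hyps b c : finite_set (sep_hyps b c).
Proof.
suff : finite_set [set fixed_points (act A) r | r in [set r | refl r /\ sep r 1%g c]].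
  by apply: sub_finite_set => _ [r [rr rc _] <-]; exists r.
apply: finite_image; have [_ gen _] := hWS; have [w [Sw <-]] := gen c.
elim/last_ind: w Sw => [|w s IH] Sw.
  rewrite big_nil (_ : [set _ | _] = set0) //; apply/seteqP; split=> // r [rr].
  by have := sep_trans 1%g 1%g 1%g rr; case: sep.
have Ss : S s by apply: Sw; rewrite mem_rcons inE eqxx.
rewrite -cats1 big_cat big_seq1 /=; move: IH; set z := (\prod_(t <- w) t)%g => IH.
apply: (@sub_finite_set _ _ ([set (z * s * z^-1)%g] `|` [set r | refl r /\ sep r 1%g z])).
  move=> r [rr]; rewrite (sep_trans _ z) // sep_mulr //.
  by case: eqP => [->|_] rz; [left|right; rewrite addbF in rz].
rewrite finite_setU; split; first exact: finite_set1.
by apply: IH => t tw; apply: Sw; rewrite mem_rcons inE tw orbT.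
Qed.

(** The walls separating [z] from [1] are those separating [z * s] from [1] together with the wall
    of the common panel, and on the shared walls [z] and [z * s] are on the same side. *)
Lemma valuation_sep z s : S s -> sep (z * s * z^-1)%g 1%g z ->
  valuation A phi z = valuation A phi (z * s)%g +
    (if positive (z * s * z^-1)%g z then 1 else -1).
Proof.
move=> Ss; set r0 := (z * s * z^-1)%g => r0z.
have rr0 : refl r0 := refl_conj z (refl_simple Ss).
have r0zs : sep r0 1%g (z * s)%g = false.
  by rewrite (sep_trans _ z) // r0z sep_mulr // eqxx.
have sep_eq r : refl r -> r != r0 -> sep r 1%g (z * s)%g = sep r 1%g z.
  by move=> rr rNr0; rewrite (sep_trans _ z) // sep_mulr // (negPf rNr0) addbF.
have pos_eq r : refl r -> r != r0 -> positive r (z * s)%g = positive r z.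
  by move=> rr rNr0; rewrite (positive_sep z _ rr) sep_mulr // (negPf rNr0) addbF.
have hypsE b : sep_hyps b z =
    if positive r0 z == b then fixed_points (act A) r0 |` sep_hyps b (z * s)%g
    else sep_hyps b (z * s)%g.
  apply/seteqP; split=> H.
    move=> [r [rr rz rb] <-]; have [rE|rNr0] := eqVneq r r0.
      by rewrite -rb rE eqxx; left.
    suff : sep_hyps b (z * s)%g (fixed_points (act A) r) by case: ifP => // _; right.
    by exists r => //; split; rewrite // ?sep_eq ?pos_eq.
  have sub : sep_hyps b (z * s)%g `<=` sep_hyps b z.
    move=> _ [r [rr rz rb] <-]; have rNr0 : r != r0.
      by apply: contraTneq rz => ->; rewrite r0zs.
    by exists r => //; split; rewrite // -?sep_eq -?pos_eq.
  by case: eqP => [pb [->|/sub]|_ /sub] //; exists r0.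
have notin b : fixed_points (act A) r0 \notin fset_set (sep_hyps b (z * s)%g).
  rewrite in_fset_set; last exact: finite_sep_hyps.
  apply/negP => /set_mem[r [rr rz _]].
  by move/(refl_inj rr rr0) => rE; rewrite rE r0zs in rz.
rewrite !valuationE !hypsE; case: (positive r0 z) => /=.
  by rewrite fset_setU1 ?cardfsU1 ?notin ?PoszD /=; [ring|exact: finite_sep_hyps].
by rewrite fset_setU1 ?cardfsU1 ?notin ?PoszD /=; [ring|exact: finite_sep_hyps].
Qed.

Lemma valuation_step z s : S s ->
  (valuation A phi (z * s)%g < valuation A phi z) = positive (z * s * z^-1)%g z.
Proof.
move=> Ss; set r0 := (z * s * z^-1)%g.
have rr0 : refl r0 := refl_conj z (refl_simple Ss).
have [r0z|r0z] := boolP (sep r0 1%g z).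
  by rewrite (valuation_sep Ss r0z) -/r0; case: positive; rewrite ?gtrDl ltrDl.
have ss : (s * s = 1)%g by rewrite -{1}(refl_inv (refl_simple Ss)) mulVg.
have zsE : (z * s * s * (z * s)^-1)%g = r0.
  by rewrite invgM (refl_inv (refl_simple Ss)) -(mulgA z) ss mulg1 mulgA.
(* Here the common wall separates [z * s] from [1] instead, so the roles of [z] and [z * s] are
   exchanged. *)
have := @valuation_sep (z * s)%g s Ss; rewrite zsE -mulgA ss mulg1 => -> //; last first.
  by rewrite (sep_trans _ z) // sep_mulr // (negPf r0z) eqxx.
rewrite (positive_sep z (z * s)%g rr0) sep_mulr // eqxx addbT.
by case: positive => /=; rewrite gtrDl.
Qed.

Lemma valuation1 : valuation A phi 1%g = 0.
Proof.
rewrite valuationE; suff hyps0 b : sep_hyps b 1%g = set0 by rewrite !hyps0 subrr.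
apply/seteqP; split=> // H [r [rr r1 _] _].
by have := sep_trans 1%g 1%g 1%g rr; rewrite r1.
Qed.

End Oriented.

(** * The action on half-spaces and directions *)

Lemma half_space_act g H D : half_space H D ->
  half_space (act A g @` H) (act A g @` D).
Proof.
move=> [a [c [a0 -> ->]]]; have [M [b [MM gE]]] := act_affine_isometry g.
have dotg v : dotp (a *m M) (g • v) = dotp a v + dotp (a *m M) b.
  by rewrite gE dotpDr MM.
exists (a *m M), (c + dotp (a *m M) b); split.
- by apply: contraNneq a0 => aM0; apply/eqP/dotp_eq0; rewrite -MM aM0 -(scale0r 0) dotpZl mul0r.
- apply/seteqP; split=> [_ [v /= vc <-]|v /= vc]; first by rewrite dotg vc.
  by exists (g^-1%g • v); [move: vc; rewrite -{1}(actKV g v) dotg /= => /addIr|rewrite actKV].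
- apply/seteqP; split=> [_ [v /= vc <-]|v /= vc]; first by rewrite dotg lerD2r.
  by exists (g^-1%g • v); [move: vc; rewrite -{1}(actKV g v) dotg lerD2r|rewrite actKV].
Qed.

Lemma fixed_points_image g r :
  act A g @` fixed_points (act A) r = fixed_points (act A) (g * r * g^-1)%g.
Proof.
apply/seteqP; split=> [_ [v rv <-]|v /fixed_points_conj rv].
  by apply/fixed_points_conj; rewrite actK.
by exists (g^-1%g • v) => //; rewrite actKV.
Qed.

Lemma act_directionK g phi : act_direction A g^-1%g (act_direction A g phi) = phi.
Proof.
have image_actK (B : set E) : act A g^-1%g @` (act A g @` B) = B.
  rewrite image_comp (_ : _ \o _ = id) ?image_id //.
  by apply/funext => v; exact: actK.
apply/seteqP; split=> [_ [_ [K phiK <-] <-]|K phiK]; first by rewrite image_actK.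
by exists (act A g @` K); [exists K|exact: image_actK].
Qed.

Lemma on_positive_side_act g phi r c : 
  on_positive_side A (act_direction A g phi)
    (fixed_points (act A) (g * r * g^-1)%g) (g * c)%g <->
  on_positive_side A phi (fixed_points (act A) r) c.
Proof.
have imp (h : W) psi r1 x : on_positive_side A psi (fixed_points (act A) r1) x ->
  on_positive_side A (act_direction A h psi)
    (fixed_points (act A) (h * r1 * h^-1)%g) (h * x)%g.
  move=> [D [qD [K psiK KD]] xD]; exists (act A h @` D).
    split; first by rewrite -fixed_points_image; exact: half_space_act.
    by exists (act A h @` K); [exists K|exact: image_subset].
  move=> _ [v Cv <-]; rewrite actM; exists (x • v) => //.
  by apply: xD; exists v.
split=> [/(imp g^-1%g)|]; last exact: imp.
by rewrite act_directionK invgK mulKg !mulgA mulVg mul1g mulgVK.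
Qed.

(** * From galleries to words, and independence of the reduced word *)

Definition fold_side phi r c := on_positive_side A phi (fixed_points (act A) r) c.

(** The hyperplane of a panel is defined through an arbitrary representative of the coset, so it
    must be seen not to depend on it. *)
Lemma panel_conj x y s t : S s -> S t -> panel x s = panel y t ->
  s = t /\ (x * s * x^-1 = y * t * y^-1)%g.
Proof.
move=> Ss St e; have [SS _ _] := hWS; have [[s1 ss] [t1 tt]] := (SS _ Ss, SS _ St).
have [xy xsy] : panel y t x /\ panel y t (x * s)%g by rewrite -e; split; [left|right].
have neq (z u : W) : u != 1%g -> (z * u)%g <> z.
  by move=> /eqP u1 h; apply: u1; apply: (mulgI z); rewrite mulg1.
case: xy xsy => /= -> [|].
- by move/(neq _ _ s1).
- by move=> h; rewrite (mulgI y _ _ h).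
- rewrite -mulgA => h; have ts : (t * s = 1)%g by apply: (mulgI y); rewrite h mulg1.
  have st : s = t by apply: (mulgI t); rewrite ts tt.
  by rewrite st invgM !mulgA mulgK.
- by rewrite -mulgA => /(mulgI y) h; case: (neq t s s1).
Qed.

(** The type determines the panels: each is the panel of that type of the preceding alcove. The next
    alcove is therefore [c * s] or [c], and positivity constrains the second case only, as [c * s]
    differs from [c]. *)
Lemma gallery_reach phi w c y : (forall s, s \in w -> S s) ->
  (exists l, [/\ gallery_from S c l, panels_type S (unzip1 l) w,
     last c (unzip2 l) = y & positively_folded_from A phi c l]) <->
  reach (fold_side phi) w c y.
Proof.
elim: w c => [|s w IH] c Sw.
  split=> [[[|[p c'] l] [_ pt <- _]] //|->]; by exists [::].
have Ss : S s by apply: Sw; rewrite inE eqxx.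
have {}IH c' := IH c' (fun t tw => Sw t (mem_behead (s := s :: w) tw)).
split.
  move=> [[|[p c'] l] [gl]] //=; case: gl => _ pc pc' gl [[_ [x pE]] pt] lasty [fold folds].
  have rest : reach (fold_side phi) w c' y by apply/IH; exists l.
  have pcs : p = panel c s.
    have [_ ss] := (let: And3 SS _ _ := hWS in SS) _ Ss.
    rewrite pE in pc *; case: pc => /= -> //; apply/seteqP; split=> z /=;
      by rewrite /panel /= -mulgA ss mulg1; tauto.
  move: pc'; rewrite pcs => -[] /= c'E; last by left; rewrite -c'E.
  right; rewrite c'E in rest; split=> //; move: fold; rewrite c'E => /(_ erefl).
  move=> [H [x' [s' [Ss' pE' ->]]] pos]; rewrite pcs in pE'.
  by have [_ cE] := panel_conj Ss Ss' pE'; rewrite /fold_side cE.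
have panel_s c' l : [set c; (c * s)%g] c' -> gallery_from S c' l ->
    gallery_from S c ((panel c s, c') :: l).
  by move=> cc' gl; split => //; [exists c, s|left].
move=> [/IH|[pos /IH]] [l [gl pt lasty fl]].
  exists ((panel c s, (c * s)%g) :: l); split=> //.
  - by apply: panel_s => //; right.
  - by split => //; split=> //; exists c.
  - split=> // ccs; exfalso; have [SS _ _] := hWS; have [/eqP s1 _] := SS _ Ss.
    by apply: s1; apply: (mulgI c); rewrite -ccs mulg1.
exists ((panel c s, c) :: l); split=> //.
- by apply: panel_s => //; left.
- by split => //; split=> //; exists c.
- by split=> // _; exists (fixed_points (act A) (c * s * c^-1)%g) => //; exists c, s.
Qed.

Lemma len_le x w : word S x w -> (len S x <= size w)%N.
Proof.
move=> xw; rewrite /len; case: pselect => [ex|//].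
by case: ex_minnP => m _; apply; apply/asboolP; exists w.
Qed.

Lemma reduced_word_exists x : exists w, reduced_word S x w.
Proof.
have [_ gen _] := hWS; have [w0 xw0] := gen x.
rewrite /reduced_word /len; case: pselect => [ex|nex].
  by case: ex_minnP => m /asboolP[w xw sz] _; exists w.
by case: nex; exists (size w0); apply/asboolP; exists w0.
Qed.

Lemma reduced_minimal x w : reduced_word S x w -> minimal_word S w.
Proof.
move=> [[Sw wx] sz]; split=> // w' Sw' w'w.
by rewrite sz; apply: len_le; split=> //; rewrite w'w.
Qed.

Lemma shadowE phi x y : shadow A phi x y <->
  exists2 w, reduced_word S x w & reach (fold_side phi) w 1%g y.
Proof.
split=> [[w [[c l] [[rw gl tl] [/= cE lasty fl]]]]|[w rw]].
  exists w => //; apply/gallery_reach; first by case: rw => -[].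
  by exists l; rewrite -cE.
case: (rw) => -[Sw _] _ /(gallery_reach _ _ _ Sw)[l [gl tl lasty fl]].
by exists w, (1%g, l).
Qed.

Lemma walls_met_refl w c r : (forall s, s \in w -> S s) -> r \in walls_met w c -> refl r.
Proof.
elim: w c => [//|s w IH] c Sw /=.
have Sw' t : t \in w -> S t by move=> tw; apply: Sw; rewrite inE tw orbT.
rewrite inE mem_cat => /predU1P[->|/orP[] /IH]; [|exact..].
by exists c, s; split=> //; apply: Sw; rewrite inE eqxx.
Qed.

(* Seen from an alcove deep inside the opposite chamber, being on the positive
   side of one of finitely many walls means being separated from that alcove. *)
Lemma reach_reduced phi x w w' y : direction A phi ->
  reduced_word S x w -> reduced_word S x w' ->
  reach (fold_side phi) w 1%g y -> reach (fold_side phi) w' 1%g y.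
Proof.
move=> /direction_vector[d [d_transverse phi_d]] rw rw'.
have [[[Sw wx] _] [[Sw' w'x] _]] := (rw, rw').
(* One alcove [g] serves the walls of both words, so that both can be compared from the same start
   [g^-1]. *)
have [|g gP] := @deep_centre d (walls_met w 1%g ++ walls_met w' 1%g).
  move=> r; rewrite mem_cat => /orP[] /walls_met_refl rr; split;
  by [exact: rr|apply: d_transverse; exact: rr].
have side (v : seq W) (r c : W) : (forall s, s \in v -> S s) ->
    (forall r, r \in walls_met v 1%g -> height r (centre g) * dotp (normal r) d < 0) ->
    r \in walls_met v 1%g ->
    folds sep (g^-1 * r * g^-1^-1)%g (g^-1 * c)%g <-> fold_side phi r c.
  move=> Sv vP rv; have rr := walls_met_refl Sv rv.
  rewrite /folds /inversion -(mulVg g) sep_conj // /fold_side.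
  rewrite (on_positive_sideP d_transverse phi_d) // (positive_sep d_transverse g c rr).
  suff -> : positive d r g = false by [].
  by apply/negbTE; rewrite -leNgt ltW // vP.
have reachE (v : seq W) : reduced_word S x v ->
    (forall r, r \in walls_met v 1%g -> height r (centre g) * dotp (normal r) d < 0) ->
    reach (fold_side phi) v 1%g y <-> reach (folds sep) v (g^-1 * 1)%g (g^-1 * y)%g.
  move=> [[Sv _] _] vP; symmetry; apply: reach_mull => r c rv; exact: (side v).
have [SS _ _] := hWS.
have [t rt] := reduced_word_exists (g^-1 * 1)%g.
rewrite !reachE //; try by move=> r rr; apply: gP; rewrite mem_cat rr ?orbT.
apply: (iffLR (reach_unique (fun s Ss => (SS s Ss).2) refl_simple refl_conj sep_trans
  sep_conj sep_simple _ (reduced_minimal rw) (reduced_minimal rw') _ _)).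
  by rewrite wx w'x.
by exists t; [exact: reduced_minimal rt|case: rt => -[]].
Qed.

(** * The two recursions for shadows *)

Lemma shadow_reduced phi x w y : direction A phi -> reduced_word S x w ->
  shadow A phi x y <-> reach (fold_side phi) w 1%g y.
Proof.
move=> dphi rw; rewrite shadowE; split=> [[w' rw']|rwy]; last by exists w.
exact: reach_reduced rw' rw.
Qed.

Lemma simple_mul s : S s -> (s * s = 1)%g.
Proof. by move=> Ss; have [SS _ _] := hWS; have [] := SS s Ss. Qed.

Lemma reduced_rcons x s w : right_descent S x s -> reduced_word S (x * s)%g w ->
  reduced_word S x (rcons w s).
Proof.
move=> [Ss lt] [[Sw wx] sz].
have xw : word S x (rcons w s).
  split=> [t|]; first by rewrite mem_rcons inE => /predU1P[->|/Sw].
  by rewrite -cats1 big_cat big_seq1 /= wx -mulgA simple_mul // mulg1.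
split=> //; apply/eqP; rewrite eqn_leq len_le // andbT size_rcons sz //.
Qed.

Lemma reduced_cons x s w : left_descent S x s -> reduced_word S (s * x)%g w ->
  reduced_word S x (s :: w).
Proof.
move=> [Ss lt] [[Sw wx] sz].
have xw : word S x (s :: w).
  split=> [t|]; first by rewrite inE => /predU1P[->|/Sw].
  by rewrite big_cons wx mulgA simple_mul // mul1g.
by split=> //; apply/eqP; rewrite eqn_leq len_le // andbT /= sz.
Qed.

Lemma fold_side_valuation phi z s : direction A phi -> S s ->
  fold_side phi (z * s * z^-1)%g z <-> valuation A phi (z * s)%g < valuation A phi z.
Proof.
move=> /direction_vector[d [dt phid]] Ss.
rewrite (valuation_step dt phid) // /fold_side; apply: on_positive_sideP => //.
exact/refl_conj/refl_simple.
Qed.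

(** Left multiplication by [s] moves the start [s] to [1] and takes the positive sides for [phi] to
    those for its image under [s]. *)
Lemma reach_simple phi s w y : S s ->
  reach (fold_side phi) w s y <->
  reach (fold_side (act_direction A s phi)) w 1%g (s * y)%g.
Proof.
move=> Ss; have ss := simple_mul Ss.
rewrite -[in X in X <-> _](mulg1 s) -[y in X in X <-> _]mul1g -ss -mulgA.
have phiK : act_direction A s (act_direction A s phi) = phi.
  by rewrite -{1}(refl_inv (refl_simple Ss)) act_directionK.
apply: reach_mull => r c _; rewrite /fold_side -[in X in X <-> _]phiK.
exact: on_positive_side_act.
Qed.

Lemma shadow_right_descent phi x s : direction A phi -> right_descent S x s ->
  shadow A phi x =
    [set (z * s)%g | z in shadow A phi (x * s)%g] `|`
    [set z | shadow A phi (x * s)%g z /\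
             valuation A phi (z * s)%g < valuation A phi z].
Proof.
move=> dphi xs; have Ss : S s by case: xs.
have [w rw] := reduced_word_exists (x * s)%g.
apply/seteqP; split=> y.
  move/(shadow_reduced _ dphi (reduced_rcons xs rw))/reach_rcons => [z rz].
  have shz : shadow A phi (x * s)%g z by apply/(shadow_reduced _ dphi rw).
  case=> [->|[/(fold_side_valuation _ dphi Ss) vz ->]]; first by left; exists z.
  by right.
move=> yP; apply/(shadow_reduced _ dphi (reduced_rcons xs rw))/reach_rcons.
case: yP => [[z /(shadow_reduced _ dphi rw) rz <-]|[/(shadow_reduced _ dphi rw) ry vy]].
  by exists z => //; left.
by exists y => //; right; split=> //; apply/(fold_side_valuation _ dphi Ss).
Qed.

(** The first letter [s] of a reduced word either crosses to [s], after which [reach_simple]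
    applies, or folds at [1]. The fold is allowed exactly when the valuation of [s] is below that of
    [1], which is 0. *)
Lemma shadow_left_descent phi x s y : direction A phi -> left_descent S x s ->
  shadow A phi x y <->
    [set (s * z)%g | z in shadow A (act_direction A s phi) (s * x)%g] y \/
    valuation A phi s < 0 /\ shadow A phi (s * x)%g y.
Proof.
move=> dphi xs; have Ss : S s by case: xs.
have [d [dt phid]] := direction_vector dphi.
have ss := simple_mul Ss.
have shx w : reduced_word S (s * x)%g w -> shadow A phi x y <->
    reach (fold_side (act_direction A s phi)) w 1%g (s * y)%g \/
    valuation A phi s < 0 /\ reach (fold_side phi) w 1%g y.
  move=> rw; rewrite (shadow_reduced _ dphi (reduced_cons xs rw)) /= mul1g.
  rewrite reach_simple //.
  have := fold_side_valuation 1%g dphi Ss.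
  by rewrite (valuation1 dt phid) !mul1g => ->.
split=> [|[[z /shadowE[w rw rz] yE]|[vs /shadowE[w rw ry]]]].
- have [w rw] := reduced_word_exists (s * x)%g.
  move/(shx w rw) => [rsy|[vs ry]]; [left|by right; split=> //; apply/shadowE; exists w].
  by exists (s * y)%g; [apply/shadowE; exists w|rewrite mulgA ss mul1g].
- by apply/(shx w rw); left; rewrite -yE mulgA ss mul1g.
- by apply/(shx w rw); right.
Qed.

End Realization.

Theorem theorem7p1 (R : realType) (n : nat) (W : groupType) (S : set W)
    (hWS : coxeter_system S) (A : affine_realization R n S)
    (phi : set (set 'rV[R]_n)) (hphi : direction A phi)
    (x s : W) (hs : S s) :
  (right_descent S x s ->
     shadow A phi x =
       [set (z * s)%g | z in shadow A phi (x * s)%g] `|`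
       [set z | shadow A phi (x * s)%g z /\
                valuation A phi (z * s)%g < valuation A phi z]) /\
  (left_descent S x s ->
     (valuation A phi s < 0 ->
        shadow A phi x =
          [set (s * z)%g | z in shadow A (act_direction A s phi) (s * x)%g]
          `|` shadow A phi (s * x)%g) /\
     (0 < valuation A phi s ->
        shadow A phi x =
          [set (s * z)%g | z in shadow A (act_direction A s phi) (s * x)%g])).
Proof.
split=> [|xs]; first exact: shadow_right_descent.
split=> vs; apply/seteqP; split=> y.
- by move/(shadow_left_descent hWS _ hphi xs) => [|[_]]; [left|right].
- by move=> yP; apply/(shadow_left_descent hWS _ hphi xs); case: yP; [left|right].
- move/(shadow_left_descent hWS _ hphi xs) => [//|[]].
  by rewrite ltNge ltW.
- by move=> yP; apply/(shadow_left_descent hWS _ hphi xs); left.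
Qed.
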